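(* For every integer $k\ge 3$, there exist $\beta>0$ and $s_0$ such that, for all integers $n,s$ with $\max\{s_0,\,n/k-\beta n\}<s\le (n-k)/k$, $$\mathrm{ex}_k\bigl(n,\{H_{k+1}^k,M_{s+1}^k\}\bigr)=s\,t_{k-1}(n-s,k-1).$$
   Context: A $k$-graph ($k$-uniform hypergraph) is a pair $(V,E)$ with $V$ finite and $E$ a set of $k$-element subsets of $V$. For a family $\mathcal F$ of $k$-graphs, a $k$-graph is $\mathcal F$-free if it contains no member of $\mathcal F$ as a subgraph; $\mathrm{ex}_k(n,\mathcal F)$ is the maximum number of edges in an $n$-vertex $\mathcal F$-free $k$-graph. $M_{s+1}^k$ is the $k$-graph consisting of $s+1$ pairwise disjoint edges. $H_{k+1}^k$ is the $k$-graph obtained from the complete graph $K_{k+1}$ by enlarging each edge with a set of $k-2$ new vertices, where all these sets of new vertices are pairwise disjoint (and disjoint from the vertex set of $K_{k+1}$). For $q\ge r\ge 2$, $T_r(m,q)$ is the $r$-graph on $[m]$ obtained from a partition of $[m]$ into $q$ parts, each of size $\lfloor m/q\rfloor$ or $\lceil m/q\rceil$, whose edges are all $r$-subsets containing at most one vertex from each part; $t_r(m,q)=|E(T_r(m,q))|$. *)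

(* Defs.v *)
From mathcomp Require Import all_boot.

Set Implicit Arguments.
Unset Strict Implicit.
Unset Printing Implicit Defensive.

Record hypergraph := Hypergraph {
  vertex : finType;
  edges : {set {set vertex}} }.

Arguments Hypergraph {vertex} edges.

(* A [k]-graph is a hypergraph [G] with [uniform k G]. *)
Definition uniform (k : nat) (G : hypergraph) : bool :=
  [forall e in edges G, #|e| == k].

(* [G] has a (not necessarily induced) subgraph isomorphic to [F]. *)
Definition contains (G F : hypergraph) : bool :=
  [exists f : {ffun vertex F -> vertex G},
     injectiveb f && [forall e in edges F, (f @: e) \in edges G]].

Definition free_of (Fs : seq hypergraph) (G : hypergraph) : bool :=
  all (fun F => ~~ contains G F) Fs.

Definition ex_number (k n : nat) (Fs : seq hypergraph) : nat :=
  \max_(E : {set {set 'I_n}}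
         | uniform k (Hypergraph E) && free_of Fs (Hypergraph E)) #|E|.

(* [M_t^k]: the vertex [(i, j)] is the [j]-th vertex of the [i]-th edge. *)
Definition matching (k t : nat) : hypergraph :=
  Hypergraph [set [set (i, j) | j : 'I_k] | i : 'I_t].

Definition clique_edge (p : nat) : finType := {A : {set 'I_p} | #|A| == 2}.

(* [H_p^k], the expansion of the complete graph [K_p]: [inl x] is the vertex
   [x] of [K_p], and the [inr (A, j)] are the [k - 2] new vertices added to
   the edge [A].  This is [k]-uniform only for [2 <= k]. *)
Definition expanded_edge (k p : nat) (A : clique_edge p) :
    {set 'I_p + clique_edge p * 'I_(k - 2)} :=
  [set inl x | x in val A] :|: [set inr (A, j) | j : 'I_(k - 2)].

Definition expanded_clique (k p : nat) : hypergraph :=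
  Hypergraph [set expanded_edge k A | A : clique_edge p].

(* [T_r(m, q)], for the partition of [{0, ..., m - 1}] into residue classes
   modulo [q]; [card_turan_part] checks that it is balanced. *)
Definition turan_part (m q j : nat) : {set 'I_m} := [set x : 'I_m | x %% q == j].

Definition turan (r m q : nat) : hypergraph :=
  Hypergraph [set e : {set 'I_m} |
    (#|e| == r) && [forall j : 'I_q, #|e :&: turan_part m q j| <= 1]].

Definition turan_number (r m q : nat) : nat := #|edges (turan r m q)|.

Lemma matching_uniform k t : uniform k (matching k t).
Proof.
apply/forall_inP => e /imsetP[i _ ->].
by rewrite card_imset ?card_ord // => x y [].
Qed.

Lemma expanded_clique_uniform k p : 2 <= k -> uniform k (expanded_clique k p).
Proof.
move=> k2; apply/forall_inP => e /imsetP[A _ ->].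
rewrite cardsU disjoint_setI0; last first.
  rewrite -setI_eq0; apply/eqP/setP => x; rewrite !inE; apply/negbTE/andP.
  by case=> /imsetP[y _ ->] /imsetP[].
rewrite cards0 subn0 card_imset; last by move=> x y [].
by rewrite card_imset ?card_ord ?(eqP (valP A)) ?subnKC // => x y [].
Qed.

(* The two values are the floor and the ceiling of [m / q]. *)
Lemma card_turan_part m q j : j < q ->
  #|turan_part m q j| = m %/ q \/ #|turan_part m q j| = m %/ q + ~~ (q %| m).
Proof.
move=> jq; have q0 : 0 < q by apply: leq_ltn_trans jq.
suff -> : #|turan_part m q j| = m %/ q + (j < m %% q).
  rewrite /dvdn; case: (ltnP j (m %% q)) => [jm|_]; last by left; rewrite addn0.
  by right; rewrite -lt0n (leq_ltn_trans _ jm).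
rewrite cardsE -sum1_card big_mkcond /=.
rewrite -(big_mkord xpredT (fun x => if x %% q == j then 1 else 0)).
elim: m => [|m IHm]; first by rewrite big_geq // div0n mod0n.
rewrite big_nat_recr //= IHm divnS // modnS.
have mq := ltn_pmod m q0.
case: (boolP (q %| m.+1)) => dv.
  have em : (m %% q).+1 = q.
    apply/eqP; rewrite eqn_leq mq /= dvdn_leq //.
    by move: dv; rewrite /dvdn -addn1 -modnDml addn1.
  rewrite ltn0 addn0 addnC.
  have : j <= m %% q by rewrite -ltnS em.
  by case: ltngtP => // _ _; rewrite addnC ?addn0 ?add0n addnC.
by rewrite add0n -addnA ltnS; case: ltngtP.
Qed.

Lemma turan_uniform r m q : uniform r (turan r m q).
Proof. by apply/forall_inP => e; rewrite inE => /andP[]. Qed.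

(* Main.v *)
(* Call a pair of vertices of G heavy if, for every set W of at most K other
   vertices, some edge contains the pair and misses W. Expanded cliques can be
   embedded greedily along heavy pairs, so the graph of heavy pairs has no
   K_{k+1}, while only O(n^(k-1)) edges contain a light pair. If G has more than
   the claimed number of edges, counting k-cliques (Zykov) shows that almost all
   vertices have heavy degree close to (1 - 1/k) n; on the set S of vertices of
   large heavy degree the graph is k-partite by Andrasfai-Erdos-Sos, and then so
   is G[S], since an edge with two vertices in one class would extend to an
   expanded clique. A k-partite k-graph without s + 1 disjoint edges is a union of
   few small matchings, which bounds the number of edges of G[S]; and each of the
   remaining vertices lies in fewer edges than the bound loses with a vertex. *)

Require Import Defs.
From mathcomp Require Import all_boot all_order all_algebra.
From mathcomp Require Import reals.
From mathcomp Require Import zify ring lra.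

Set Implicit Arguments.
Unset Strict Implicit.
Unset Printing Implicit Defensive.

(** In the main estimates the uniformity is [k.+1], with [Q = k.+1] and [L = n / Q]. The condition
    on [s] puts it so close to [L] that the claimed bound is at least [(1 - d ^ 2 / 16) * L ^ k.+1],
    while Zykov's theorem allows at most [L ^ k.+1] cliques; this small gap is what makes stability
    available. Two degree thresholds are used: at most [(1 + d * Q) * L] and at most
    [(1 + eps * Q) * L] heavy non-neighbours, with [d] much smaller than [eps]. Only [O(d * L)]
    vertices fail the first, so the error terms in the degree count are of order [d]; a vertex
    failing the second has a deficit of order [eps], which beats them. With a single threshold,
    error and deficit would be comparable. Exactness comes from the last comparison: the edges
    inside [S] satisfy an exact bound, and each vertex outside [S] is paid for separately, so no
    error term survives. Estimates that involve quotients are kept in natural numbers with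
    denominators cleared, whence factors such as [k ^ k]. *)

Lemma nat_AGM a d r : a * d ^ r * r.+1 ^ r.+1 <= (a + d) ^ r.+1 * r ^ r.
Proof.
case: r => [|r]; first by rewrite !muln1 expn1; exact: leq_addr.
set R := r.+1.
(* AM-GM is applied to [R * a] taken once and [d] taken [R] times. *)
pose E (i : 'I_R.+1) : int := if i == ord0 then ((R * a)%:R)%R else (d%:R)%R.
have := (@Num.Theory.leif_AGM_scaled int 'I_R.+1 predT E _).1.
rewrite big_ord_recl [X in (_ <= X ^+ _)%R]big_ord_recl /E eqxx /=.
rewrite big_const_ord GRing.iter_mulr_1 big_const_ord GRing.iter_addr_0 cardT size_enum_ord.
rewrite -!GRing.mulrnA -GRing.natrD -!GRing.natrX -GRing.natrM Num.Theory.ler_nat => H.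
have {H} : R * a * R.+1 * (d * R.+1) ^ R <= (R * a + d * R) ^ R.+1.
  by apply: H => i _; case: ifP => _; apply: Num.Theory.mulrn_wge0.
move: (ltn0Sn r) => R0.
rewrite [d * R]mulnC -mulnDr !expnMn [R ^ R.+1]expnS [R.+1 ^ R.+1]expnS => H.

rewrite -(leq_pmul2l R0).
apply: leq_trans (leq_trans H _); rewrite leq_eqVlt; apply/orP; left; apply/eqP.
  by rewrite -!mulnA (mulnCA (d ^ R)) [d ^ R * _]mulnC.
by rewrite -[RHS]mulnCA mulnC.
Qed.

(** * Cliques in graphs *)

Section Graphs.

Variable V : finType.
Implicit Types (e : rel V) (S T A B X U W : {set V}) (x y : V).

Definition clique e A : bool := [forall x in A, forall y in A, (x != y) ==> e x y].

Definition cliques e r S : {set {set V}} :=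
  [set A : {set V} | [&& A \subset S, #|A| == r & clique e A]].

Definition nb e S x : {set V} := [set y in S | e x y].

Lemma cliqueP e A : reflect {in A &, forall x y, x != y -> e x y} (clique e A).
Proof.
apply: (iffP forall_inP) => [h x y xA yA xy|h x xA].
  by have /forall_inP /(_ y yA) /implyP := h x xA; apply.
by apply/forall_inP => y yA; apply/implyP; apply: h.
Qed.

Lemma cliqueS e A B : A \subset B -> clique e B -> clique e A.
Proof.
move=> /subsetP AB /cliqueP h; apply/cliqueP => x y xA yA.
by apply: h; apply: AB.
Qed.

Lemma cliqueU1 e x A : symmetric e -> {in A, forall y, e x y} -> clique e A ->
  clique e (x |: A).
Proof.
move=> es h /cliqueP hA; apply/cliqueP => u v.
rewrite !inE => /predU1P[->|uA] /predU1P[->|vA]; rewrite ?eqxx //.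
- by move=> _; apply: h.
- by move=> _; rewrite es; apply: h.
- exact: hA.
Qed.

Lemma cliquesP e r S A :
  reflect [/\ A \subset S, #|A| = r & clique e A] (A \in cliques e r S).
Proof. by rewrite inE; apply: (iffP and3P) => -[? /eqP ? ?]. Qed.

Lemma cliquesS e r S T : S \subset T -> cliques e r S \subset cliques e r T.
Proof.
move=> ST; apply/subsetP => A /cliquesP[AS Ar Ac]; apply/cliquesP; split=> //.
exact: subset_trans ST.
Qed.

Lemma cliques_eq0S e r S T : S \subset T -> cliques e r T = set0 -> cliques e r S = set0.
Proof.
by move=> ST h; apply/eqP; rewrite -subset0 -h; apply: cliquesS.
Qed.

Lemma card_hitting (F : {set {set V}}) W : {in F, forall A, ~~ [disjoint A & W]} ->
  #|F| <= \sum_(w in W) #|[set A in F | w \in A]|.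
Proof.
move=> h; under eq_bigr do rewrite -sum1_card.
rewrite (exchange_big_dep (mem F)) /= => [|A B _]; last by rewrite inE => /andP[].
rewrite -sum1_card; apply: leq_sum => A AF.
have /pred0Pn[w /andP[/= wA wW]] := h A AF.
by rewrite sum1dep_card card_gt0; apply/set0Pn; exists w; rewrite !inE wA wW AF.
Qed.

Lemma card_le_setU1 (F H : {set {set V}}) x :
  {in F, forall A, x \in A} -> {in F, forall A, A :\ x \in H} -> #|F| <= #|H|.
Proof.
move=> xF FH; rewrite -(card_in_imset (f := fun A => A :\ x)).
  by apply/subset_leq_card/subsetP => _ /imsetP[A AF ->]; apply: FH.
by move=> A B AF BF /= AB; rewrite -(setD1K (xF A AF)) -(setD1K (xF B BF)) AB.
Qed.

Lemma nb_sub e S x : nb e S x \subset S.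
Proof. by apply/subsetP => y; rewrite inE => /andP[]. Qed.

Lemma card_cliques_at e r S x : irreflexive e ->
  #|[set A in cliques e r.+1 S | x \in A]| <= #|cliques e r (nb e S x)|.
Proof.
move=> ei; apply: (@card_le_setU1 _ _ x) => A; rewrite inE => /andP[] // /cliquesP[AS Ar Ac] xA.
apply/cliquesP; split.
- apply/subsetP => y /setD1P[yx yA]; rewrite inE (subsetP AS) //=.
  by apply: (cliqueP _ _ Ac) => //; rewrite eq_sym.
- by apply/eqP; rewrite -eqSS -Ar (cardsD1 x A) xA.
- exact: cliqueS (subD1set A x) Ac.
Qed.

Lemma cliques_nb_eq0 e r S x : symmetric e -> irreflexive e -> x \in S ->
  cliques e r.+1 S = set0 -> cliques e r (nb e S x) = set0.
Proof.
move=> es ei xS h; apply/eqP/set0Pn => -[A /cliquesP[AN Ar Ac]].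
have xA : x \notin A by apply/negP => /(subsetP AN); rewrite inE ei andbF.
suff : x |: A \in cliques e r.+1 S by rewrite h inE.
apply/cliquesP; split.
- by rewrite subUset sub1set xS (subset_trans AN) // nb_sub.
- by rewrite cardsU1 xA Ar.
- by apply: cliqueU1 => // y /(subsetP AN); rewrite inE => /andP[].
Qed.

Lemma cliques0 e S : cliques e 0 S = [set set0].
Proof.
apply/setP => A; rewrite !inE cards_eq0; apply/and3P/eqP => [[_ /eqP]//|->].
by rewrite sub0set eqxx; split=> //; apply/cliqueP => x y; rewrite inE.
Qed.

(* Every [r+1]-clique meets the non-neighbourhood of a vertex of maximum degree. *)
Lemma zykov e r S : symmetric e -> irreflexive e ->
  cliques e r.+1 S = set0 -> #|cliques e r S| * r ^ r <= #|S| ^ r.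
Proof.
move=> es ei; elim: r S => [|r IHr] S h; first by rewrite cliques0 cards1.
have [->|[v0 v0S]] := set_0Vmem S.
  suff -> : cliques e r.+1 set0 = set0 by rewrite cards0.
  apply/eqP/set0Pn => -[A /cliquesP[]].
  by rewrite subset0 => /eqP ->; rewrite cards0.
have [v vS vmax] := @arg_maxnP _ v0 (mem S) (fun v => #|nb e S v|) v0S.
set d := #|nb e S v| in vmax.
have hit : {in cliques e r.+1 S, forall A, ~~ [disjoint A & S :\: nb e S v]}.
  move=> A AC; apply/negP => dis.
  suff : A \in cliques e r.+1 (nb e S v) by rewrite cliques_nb_eq0 // inE.
  move/cliquesP: AC => [AS Ar Ac]; apply/cliquesP; split=> //.
  apply/subsetP => x xA; apply/negPn/negP => xN.
  move/pred0P: dis => /(_ x) /=; rewrite xA in_setD xN.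
  by rewrite (subsetP AS).
have le1 : #|cliques e r.+1 S| * r ^ r <= (#|S| - d) * d ^ r.
  apply: leq_trans (leq_mul (card_hitting hit) (leqnn _)) _.
  rewrite big_distrl /= -[#|S|](cardsID (nb e S v)) (setIidPr (nb_sub _ _ _)) addKn.
  rewrite -sum_nat_const; apply: leq_sum => w /setDP[wS _].
  apply: leq_trans (leq_mul (card_cliques_at _ _ _ ei) (leqnn _)) _.
  apply: leq_trans (IHr _ _) _; first exact: cliques_nb_eq0.
  by case: r {IHr h hit} => // r; rewrite leq_exp2r //; apply: vmax.
have dS : d <= #|S| by apply/subset_leq_card/nb_sub.
have r0 : 0 < r ^ r by rewrite expn_gt0; case: (r).
rewrite -(leq_pmul2r r0) mulnAC; apply: leq_trans (leq_mul le1 (leqnn _)) _.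
by rewrite -{2}(subnK dS); apply: nat_AGM.
Qed.

Lemma card_cliques_del e r S U : irreflexive e ->
  #|cliques e r.+1 S| <= #|cliques e r.+1 (S :\: U)| + \sum_(u in U) #|cliques e r (nb e S u)|.
Proof.
move=> ei; rewrite -(cardsID (cliques e r.+1 (S :\: U)) (cliques e r.+1 S)).
apply: leq_add; first exact/subset_leq_card/subsetIr.
apply: leq_trans (card_hitting (W := U) _) _; last first.
  apply: leq_sum => u uU; apply: leq_trans (card_cliques_at r S u ei).
  by apply/subset_leq_card/subsetP => A; rewrite !inE => /andP[/andP[_ ->] ->].
move=> A /setDP[/cliquesP[AS Ar Ac] /cliquesP nA]; apply/negP => dis; apply: nA.
by split=> //; rewrite subsetD AS.
Qed.

(* A greedy choice: each vertex chosen excludes at most [a] candidates. *)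
Lemma greedy_clique e S a j X : symmetric e -> irreflexive e ->
  {in S, forall x, #|S :\: nb e S x| <= a} -> X \subset S -> j * a < #|X| ->
  cliques e j.+1 X != set0.
Proof.
move=> es ei ha; elim: j X => [|j IHj] X XS jX.
  have /card_gt0P[x xX] : 0 < #|X| by exact: leq_ltn_trans jX.
  apply/set0Pn; exists [set x]; apply/cliquesP; split; rewrite ?cards1 ?sub1set //.
  by apply/cliqueP => u v /set1P-> /set1P->; rewrite eqxx.
have /card_gt0P[x xX] : 0 < #|X| by exact: leq_ltn_trans jX.
have nz : cliques e j.+1 (nb e X x) != set0.
  apply: IHj; first exact: subset_trans (nb_sub _ _ _) XS.
  have := ha x (subsetP XS x xX); rewrite -(cardsID (nb e X x) X) in jX => hx.
  have h1 : #|X :\: nb e X x| <= #|S :\: nb e S x|.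
    apply/subset_leq_card/subsetP => y; rewrite !inE => /andP[+ yX].
    by rewrite yX (subsetP XS y yX) => /= ->.
  have h2 : #|X :&: nb e X x| <= #|nb e X x| by apply/subset_leq_card/subsetIr.
  rewrite mulSn in jX; lia.
by apply: contra nz => /eqP h; rewrite (cliques_nb_eq0 es ei xX h).
Qed.
End Graphs.

Lemma exists_subset_card (V : finType) (A : {set V}) j : j <= #|A| ->
  exists2 B : {set V}, B \subset A & #|B| = j.
Proof.
move=> jA; exists [set x in take j (enum A)].
  by apply/subsetP => x; rewrite inE => /mem_take; rewrite mem_enum.
rewrite cardsE (card_uniqP _) ?take_uniq ?enum_uniq //.
by rewrite size_takel // -cardE.
Qed.

Lemma leq_card_bigcup (V I : finType) (P : pred I) (F : I -> {set V}) :
  #|\bigcup_(i | P i) F i| <= \sum_(i | P i) #|F i|.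
Proof.
elim/big_ind2: _ => [|A a B b hA hB|//]; first by rewrite cards0.
by rewrite cardsU; apply: leq_trans (leq_subr _ _) (leq_add hA hB).
Qed.

(** * Maximal clique-free graphs and colourings from high minimum degree *)

Section Colouring.

Variable V : finType.
Implicit Types (e : rel V) (S T A B X U W Q : {set V}) (x y u v w : V).

(** In a maximal relation without such cliques, adding a missing pair must create one. That clique
    contains both ends, and its other [r] vertices are common neighbours of them. *)
Lemma cliques_maximal e S r : symmetric e -> irreflexive e ->
  cliques e r.+2 S = set0 ->
  exists e', [/\ symmetric e', irreflexive e', subrel e e', cliques e' r.+2 S = set0 &
    {in S &, forall u w, u != w -> ~~ e' u w ->
       cliques e' r (nb e' S u :&: nb e' S w) != set0}].
Proof.
move=> es ei h.
pose rl (E : {set V * V}) : rel V := fun x y => (x, y) \in E.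
pose P (E : {set V * V}) := [&& [forall x, ~~ rl E x x],
  [forall x, forall y, rl E x y ==> rl E y x] & cliques (rl E) r.+2 S == set0].
have PE : P [set p | e p.1 p.2].
  apply/and3P; split.
  - by apply/forallP => x; rewrite /rl inE ei.
  - by apply/forallP => x; apply/forallP => y; rewrite /rl !inE /= es implybb.
  - rewrite -h; apply/eqP/setP => A; apply/cliquesP/cliquesP => -[AS Ar /cliqueP Ac];
      by split=> //; apply/cliqueP => x y xA yA /(Ac x y xA yA); rewrite /rl inE.
have [E /maxsetP[/and3P[/forallP Ei /forallP Es /eqP E0] Emax] /subsetP eE] := maxset_exists PE.
have rlE : symmetric (rl E).
  move=> x y; have /forallP /(_ y) /implyP hxy := Es x.
  by have /forallP /(_ x) /implyP hyx := Es y; apply/idP/idP.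
exists (rl E); split=> //.
- by move=> x; apply/negbTE.
- by move=> x y exy; apply: eE; rewrite inE.
move=> u w uS wS uw nuw.
pose E' := (u, w) |: ((w, u) |: E).
have EE' : E \subset E' by rewrite /E' setUA subsetUr.
have rlE' x y : rl E' x y = [|| (x == u) && (y == w), (x == w) && (y == u) | rl E x y].
  by rewrite /rl /E' !inE !xpair_eqE.
have [A /cliquesP[AS Ar /cliqueP Ac]] : exists A, A \in cliques (rl E') r.+2 S.
  apply/set0Pn/negP => c0; have : P E'.
    apply/and3P; split=> //.
    - apply/forallP => x; rewrite rlE' (negbTE (Ei x)) orbF.
      by apply/negP => /orP[] /andP[/eqP-> /eqP] eq; rewrite eq eqxx in uw.
    - apply/forallP => x; apply/forallP => y; apply/implyP; rewrite !rlE' rlE.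
      by case/or3P => [/andP[-> ->]|/andP[-> ->]|->]; rewrite ?orbT.
  move=> /Emax /(_ EE') EE; case/negP: nuw; rewrite -EE rlE' !eqxx //.
have cl B : B \subset A -> ~~ ((u \in B) && (w \in B)) -> clique (rl E) B.
  move=> /subsetP BA nB; apply/cliqueP => x y xB yB xy.
  have := Ac x y (BA x xB) (BA y yB) xy; rewrite rlE'.
  by case/or3P => // /andP[/eqP ex /eqP ey]; case/negP: nB; rewrite -ex -ey xB yB.
have /andP[uA wA] : (u \in A) && (w \in A).
  apply: contraT => /(cl A (subxx _)) AC.
  by have : A \in cliques (rl E) r.+2 S; [apply/cliquesP|rewrite E0 inE].
apply/set0Pn; exists (A :\ u :\ w); apply/cliquesP; split.
- apply/subsetP => x; rewrite !inE => /and3P[xw xu xA]; rewrite (subsetP AS) //=.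
  move: (Ac u x uA xA); move: (Ac w x wA xA).
  rewrite eq_sym xw eq_sym xu !rlE' => /(_ isT) + /(_ isT).
  by rewrite (negbTE xw) (negbTE xu) !andbF /= => -> ->.
- by move: Ar; rewrite (cardsD1 u A) uA (cardsD1 w (A :\ u)) !inE wA eq_sym uw => -[].
- by apply: cl; rewrite ?inE ?eqxx ?andbF // (subset_trans (subD1set _ _)) ?subD1set.
Qed.

(** Let [Z] be the set of vertices joined to all of [Q]. A vertex of [Z] adjacent to [u] or to [w]
    would complete [Q] and that end to an [r.+2]-clique, so [Z] lies in both non-neighbourhoods;
    each vertex of [Q] removes at most [a] vertices from [Z]. *)
Lemma common_nonneighbours e S u w r a Q : symmetric e -> irreflexive e ->
  u \in S -> w \in S ->
  cliques e r.+2 S = set0 -> {in S, forall x, #|S :\: nb e S x| <= a} ->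
  Q \in cliques e r (nb e S u :&: nb e S w) ->
  #|S| <= #|(S :\: nb e S u) :&: (S :\: nb e S w)| + r * a.
Proof.
move=> es ei uS wS h0 ha /cliquesP[QN Qr Qc].
have QNx x : x = u \/ x = w -> {in Q, forall q, e x q}.
  move=> xuw q /(subsetP QN); rewrite !inE => /andP[/andP[_ eu] /andP[_ ew]].
  by case: xuw => ->.
have QS : Q \subset S.
  by apply: subset_trans QN _; apply: subset_trans (subsetIl _ _) (nb_sub _ _ _).
pose Z := [set z in S | [forall q in Q, e z q]].
have ZN x : x \in S -> x = u \/ x = w -> Z \subset S :\: nb e S x.
  move=> xS /QNx xQ; apply/subsetP => z; rewrite !inE => /andP[zS /forall_inP zQ].
  rewrite zS andbT /=; apply/negP => exz.
  have : z |: (x |: Q) \in cliques e r.+2 S; last by rewrite h0 inE.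
  have xnQ : x \notin Q by apply/negP => /xQ; rewrite ei.
  have znQ : z \notin Q by apply/negP => /zQ; rewrite ei.
  have zx : z != x by apply: contraTneq exz => ->; rewrite ei.
  apply/cliquesP; split.
  - by rewrite !subUset !sub1set zS xS.
  - by rewrite !cardsU1 xnQ Qr !inE negb_or zx znQ.
  - apply: cliqueU1 => // [y|]; last exact: cliqueU1.
    by rewrite !inE => /predU1P[->|/zQ //]; rewrite es.
have SZ : #|S :\: Z| <= r * a.
  have -> : S :\: Z = \bigcup_(q in Q) (S :\: nb e S q).
    apply/setP => z; rewrite !inE; apply/andP/bigcupP => [[+ zS]|[q qQ]].
      rewrite zS /= => /forall_inPn[q qQ nzq]; exists q => //.
      by rewrite !inE zS andbT /= es.
    rewrite !inE => /andP[+ zS]; rewrite zS => nqz; split=> //=.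
    by apply/forall_inPn; exists q => //; rewrite es.
  rewrite -Qr -sum_nat_const; apply: leq_trans (leq_card_bigcup _ _) _.
  by apply: leq_sum => q qQ; apply/ha/(subsetP QS).
have ZS : Z \subset S by apply/subsetP => z; rewrite inE => /andP[].
rewrite -(cardsID Z S) (setIidPr ZS); apply: leq_add SZ.
by apply: subset_leq_card; rewrite subsetI !ZN; auto.
Qed.

(* The Andrasfai-Erdos-Sos theorem. In a maximal supergraph without
   [r+3]-cliques non-adjacency is transitive: if [w] is joined to neither end of
   an edge [uv], then the non-neighbourhoods of [u] and [v] both nearly coincide
   with that of [w], so [uv] has enough common neighbours for a clique. *)
Lemma andrasfai e S r a : symmetric e -> irreflexive e ->
  cliques e r.+3 S = set0 -> {in S, forall x, #|S :\: nb e S x| <= a} ->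
  (3 * r + 5) * a < 3 * #|S| ->
  exists c : V -> 'I_r.+2, {in S &, forall x y, e x y -> c x != c y}.
Proof.
move=> es0 ei0 h0 ha0 hS.
have [e' [es ei ee' h emax]] := cliques_maximal es0 ei0 h0.
have ha : {in S, forall x, #|S :\: nb e' S x| <= a}.
  move=> x xS; apply: leq_trans (ha0 x xS); apply/subset_leq_card/subsetP => y.
  by rewrite !inE => /andP[+ yS]; rewrite yS !andbT => /=; apply: contra => /ee'.
have near u w : u \in S -> w \in S -> u != w -> ~~ e' u w ->
    #|S| <= #|(S :\: nb e' S u) :&: (S :\: nb e' S w)| + r.+1 * a.
  move=> uS wS uw /(emax u w uS wS uw) /set0Pn[Q].
  exact: common_nonneighbours.
(* More than [r * a] common neighbours of an edge would contain, by the greedy choice, an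
   [r.+1]-clique, hence an [r.+3]-clique together with the edge. *)
have far u v : u \in S -> v \in S -> e' u v ->
    #|S| + #|(S :\: nb e' S u) :&: (S :\: nb e' S v)| <= (r + 2) * a.
  move=> uS vS uv; have uv' : #|nb e' S u :&: nb e' S v| <= r * a.
    rewrite leqNgt; apply/negP => big.
    have NS : nb e' S u :&: nb e' S v \subset S.
      by rewrite (subset_trans (subsetIl _ _)) ?nb_sub.
    have /set0Pn[Q] := greedy_clique es ei ha NS big.
    have -> : nb e' S u :&: nb e' S v = nb e' (nb e' S u) v.
      by apply/setP => x; rewrite !inE; case: (x \in S).
    rewrite (@cliques_nb_eq0 _ e' r.+1 (nb e' S u)) ?inE ?vS //.
    exact: cliques_nb_eq0.
  have := ha u uS; have := ha v vS.
  have := cardsID (nb e' S u :&: nb e' S v) S.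
  have NS : nb e' S u :&: nb e' S v \subset S.
    by rewrite (subset_trans (subsetIl _ _)) ?nb_sub.
  rewrite (setIidPr NS) setDIr cardsU; lia.
have trans w u v : w \in S -> u \in S -> v \in S -> ~~ e' u w -> ~~ e' v w -> ~~ e' u v.
  move=> wS uS vS uw vw; apply/negP => uv.
  have [eq|nuw] := eqVneq u w; first by rewrite -eq es uv in vw.
  have [eq|nvw] := eqVneq v w; first by rewrite -eq uv in uw.
  (* For the non-neighbourhoods [A], [B], [C] of [u], [v], [w], one has [#|A :&: C| + #|B :&: C| <=
     a + #|A :&: B|]. Combined with these three bounds this gives [3 * #|S| <= (3 * r + 5) * a],
     against the hypothesis. *)
  have := far u v uS vS uv; have := near u w uS wS nuw uw; have := near v w vS wS nvw vw.
  set A := _ :\: nb e' S u; set B := _ :\: nb e' S v; set C := _ :\: nb e' S w.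
  have := ha w wS; rewrite -/C.
  have := cardsUI (A :&: C) (B :&: C).
  have h1 : #|A :&: C :|: B :&: C| <= #|C| by rewrite subset_leq_card // subUset !subsetIr.
  have h2 : #|A :&: C :&: (B :&: C)| <= #|A :&: B|.
    by rewrite subset_leq_card // setIACA subsetIl.
  lia.
(* Non-adjacency is now an equivalence relation on [S], and [f] picks a representative that depends
   only on the class; the pick succeeds because [x] is not adjacent to itself. Representatives of
   distinct classes are adjacent, so there are at most [r.+2] classes. *)
pose f x := odflt x [pick y in S | ~~ e' x y].
have fP x : x \in S -> f x \in S /\ ~~ e' x (f x).
  move=> xS; rewrite /f; case: pickP => [y /andP[] //|/(_ x)].
  by rewrite xS ei.
have fE x y : x \in S -> y \in S -> ~~ e' x y -> f x = f y.
  move=> xS yS xy; rewrite /f.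
  have -> : [pick z in S | ~~ e' x z] = [pick z in S | ~~ e' y z].
    apply: eq_pick => z /=; case zS: (z \in S) => //=; apply/idP/idP => h1.
      by apply: (trans x); rewrite // es.
    by apply: (trans y); rewrite // es.
  by case: pickP => [//|/(_ y)]; rewrite yS ei.
pose R := f @: S.
have Rc : clique e' R.
  apply/cliqueP => _ _ /imsetP[x xS ->] /imsetP[y yS ->]; apply: contraNT => fxy.
  have [[fx xfx] [fy yfy]] := (fP x xS, fP y yS); apply/eqP/fE => //.
  apply: (trans (f x)) => //; apply: (trans (f y)) => //; by rewrite es.
have Rr : #|R| <= r.+2.
  rewrite leqNgt; apply/negP => /exists_subset_card[A AR Ar].
  suff : A \in cliques e' r.+3 S by rewrite h inE.
  apply/cliquesP; split=> //; last exact: cliqueS Rc.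
  by apply: subset_trans AR _; apply/subsetP => _ /imsetP[x xS ->]; case: (fP x xS).
exists (fun x => inord (index (f x) (enum R))) => x y xS yS exy.
have ind z : z \in S -> index (f z) (enum R) < r.+2.
  move=> zS; apply: leq_trans Rr; rewrite cardE index_mem mem_enum.
  exact: imset_f.
apply: contraTneq exy => /(congr1 val); rewrite /= !inordK ?ind // => eq.
have {}eq : f x = f y.
  by move: (congr1 (nth (f x) (enum R)) eq); rewrite !nth_index ?mem_enum ?imset_f.
have [[_ xfx] [fy yfy]] := (fP x xS, fP y yS).
apply: contra (ee' x y) _; apply: (trans (f y)) => //; by rewrite -?eq.
Qed.
End Colouring.

(** * Heavy pairs *)

Section Expansion.

Variable V : finType.
Implicit Types (G : {set {set V}}) (C W Q g : {set V}) (x y u v : V).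

Definition heavy G K : rel V := fun x y =>
  (x != y) && [forall W : {set V}, [&& #|W| <= K, x \notin W & y \notin W] ==>
                [exists g in G, [&& x \in g, y \in g & [disjoint g & W]]]].

Lemma heavy_irr G K : irreflexive (heavy G K).
Proof. by move=> x; rewrite /heavy eqxx. Qed.

Lemma heavy_sym G K : symmetric (heavy G K).
Proof.
move=> x y; rewrite /heavy eq_sym; congr (_ && _).
apply: eq_forallb => W; rewrite (andbC (y \notin W)); congr (_ ==> _).
by apply: eq_existsb => g; congr (_ && _); rewrite andbCA.
Qed.

Lemma heavyP G K x y W : heavy G K x y -> #|W| <= K -> x \notin W -> y \notin W ->
  exists g, [/\ g \in G, x \in g, y \in g & [disjoint g & W]].
Proof.
move=> /andP[_ /forallP /(_ W) /implyP h] WK xW yW.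
have /exists_inP[g gG /and3P[]] : [exists g in G, [&& x \in g, y \in g & [disjoint g & W]]].
  by apply: h; rewrite WK xW.
by exists g.
Qed.

(** The index [A0] receives the prescribed edge [e0] and comes first, since its pair may be light.
    Each later edge avoids all earlier edges and the core [C], apart from its own pair, so [K] has
    to cover the core and all the edges. *)
Lemma greedy_edges (T : finType) k K G C (z : T -> {set V}) (A0 : T) e0 :
  {in G, forall g, #|g| = k} ->
  (forall A, z A \subset C) -> e0 \in G -> e0 :&: C = z A0 ->
  (forall A W, A != A0 -> #|W| <= K -> [disjoint z A & W] ->
     exists g, [/\ g \in G, z A \subset g & [disjoint g & W]]) ->
  #|C| + #|T| * k <= K ->
  exists F : T -> {set V},
    [/\ forall A, F A \in G, forall A, F A :&: C = z A &
        forall A B, A != B -> F A :&: F B \subset C].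
Proof.
move=> Gk zC e0G e0C hz hK.
suff main L : uniq (A0 :: L) -> exists F : T -> {set V},
    [/\ {in A0 :: L, forall A, F A \in G}, {in A0 :: L, forall A, F A :&: C = z A} &
        {in A0 :: L &, forall A B, A != B -> F A :&: F B \subset C}].
  have [|F [h1 h2 h3]] := main (rem A0 (enum T)).
    by rewrite /= rem_uniq ?enum_uniq // mem_rem_uniqF ?enum_uniq.
  have mT A : A \in A0 :: rem A0 (enum T).
    by rewrite -(perm_mem (perm_to_rem _)) mem_enum.
  by exists F; split=> *; [apply: h1|apply: h2|apply: h3].
elim: L => [_|B L IHL].
  exists (fun=> e0); split=> [A|A|A B]; rewrite !inE => /eqP eA //; first by rewrite eA.
  by move=> /eqP eB; rewrite eA eB eqxx.
rewrite /= inE negb_or -andbA => /and4P[A0B A0L BL uL].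
have [|F [FG FC FF]] := IHL; first by rewrite /= A0L.
pose W := (C :|: \bigcup_(A in A0 :: L) F A) :\: z B.
have WK : #|W| <= K.
  apply: leq_trans hK; apply: leq_trans (subset_leq_card (subsetDl _ _)) _.
  rewrite cardsU; apply: leq_trans (leq_subr _ _) (leq_add (leqnn _) _).
  apply: leq_trans (leq_card_bigcup _ _) _.
  rewrite (eq_bigr (fun=> k)) => [|A AL]; last by rewrite Gk // FG.
  by rewrite sum_nat_const leq_mul2r max_card orbT.
have [||g [gG zg gW]] := hz B W _ WK; first by rewrite eq_sym.
  by rewrite -setI_eq0 setIDA setDIl setDv set0I.
have gz x : x \in g -> x \in C :|: \bigcup_(A in A0 :: L) F A -> x \in z B.
  move=> xg xU; apply: contraTT gW => xz; apply/pred0Pn; exists x => /=.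
  by rewrite xg inE xz.
have gC : g :&: C = z B.
  apply/setP => x; apply/setIP/idP => [[xg xC]|xz].
    by apply: gz => //; rewrite inE xC.
  by rewrite (subsetP zg) // (subsetP (zC B)).
have gF A : A \in A0 :: L -> g :&: F A \subset C.
  move=> AL; apply/subsetP => x /setIP[xg xF]; apply: (subsetP (zC B)); apply: gz => //.
  by rewrite inE; apply/orP; right; apply/bigcupP; exists A.
have mL A : A \in [:: A0, B & L] -> A != B -> A \in A0 :: L.
  by move=> h /negbTE AB; move: h; rewrite !inE AB.
exists (fun A => if A == B then g else F A); split=> [A|A|A A'] AL.
- by case: eqVneq => // AB; apply/FG/mL.
- by case: eqVneq => [->//|AB]; apply/FC/mL.
move=> A'L AA'; case: eqVneq => [eA|AB]; case: eqVneq => [eA'|A'B].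
- by rewrite eA eA' eqxx in AA'.
- by apply/gF/mL.
- by rewrite setIC; apply/gF/mL.
- by apply: FF => //; apply: mL.
Qed.

(** Outside the core [C] each [F A] has exactly [k - 2] vertices, and these sets are pairwise
    disjoint: they serve as the new vertices. *)
Lemma contains_expanded_clique k p x0 G C (z : 'I_p -> V) (F : clique_edge p -> {set V}) :
  1 < k -> {in G, forall g, #|g| = k} -> injective z -> (forall i, z i \in C) ->
  (forall A, F A \in G) -> (forall A, F A :&: C = z @: val A) ->
  (forall A B, A != B -> F A :&: F B \subset C) ->
  contains (Hypergraph G) (expanded_clique k p).
Proof.
move=> k1 Gk zi zC FG FC FF.
have cF A : size (enum (F A :\: C)) = k - 2.
  rewrite -cardE cardsD FC Gk // card_imset //.
  by have /eqP -> := valP A.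
pose ext (A : clique_edge p) (j : 'I_(k - 2)) := nth x0 (enum (F A :\: C)) j.
have extP A j : ext A j \in F A :\: C by rewrite -mem_enum mem_nth // cF.
pose f (t : vertex (expanded_clique k p)) : V :=
  match t with inl i => z i | inr (A, j) => ext A j end.
have fi : injective f.
  move=> [i|[A j]] [i'|[A' j']] /= eq.
  - by rewrite (zi _ _ eq).
  - by have := extP A' j'; rewrite -eq inE zC.
  - by have := extP A j; rewrite eq inE zC.
  have eA : A = A'.
    apply/eqP; apply: contraT => AA'; have /subsetP /(_ (ext A j)) := FF A A' AA'.
    have /setDP[h1 h2] := extP A j; have /setDP[h3 _] := extP A' j'.
    by rewrite (negbTE h2) inE h1 eq h3 => /(_ isT).
  subst A'; congr (inr (_, _)); apply/val_inj/eqP.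
  by move/eqP: eq; rewrite /ext nth_uniq ?cF ?enum_uniq.
apply/existsP; exists [ffun t => f t]; apply/andP; split.
  by apply/injectiveP => t t'; rewrite !ffunE; apply: fi.
apply/forall_inP => _ /imsetP[A _ ->] /=.
have -> : [ffun t => f t] @: expanded_edge k A = f @: expanded_edge k A.
  by apply: eq_imset => t; rewrite ffunE.
suff -> : f @: expanded_edge k A = F A by [].
apply/eqP; rewrite eqEcard; apply/andP; split.
  apply/subsetP => _ /imsetP[t + ->]; rewrite inE => /orP[] /imsetP[i iA ->] /=.
    have : z i \in F A :&: C by rewrite FC imset_f.
    by rewrite inE => /andP[].
  by have /setDP[] := extP A i.
rewrite card_imset // Gk //.
have /forall_inP /(_ (expanded_edge k A)) := expanded_clique_uniform p k1.
by move=> /(_ (imset_f _ _)) /eqP -> .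
Qed.

(** The pair [x], [y] may be light: one edge through it that misses [Q] suffices, because this edge
    is fixed before the heavy pairs are expanded. Both the clique-freeness of the heavy graph and
    the colouring of edges rest on this. *)
Lemma heavy_clique_covered k p K G e0 x y Q :
  1 < k -> {in G, forall g, #|g| = k} ->
  ~~ contains (Hypergraph G) (expanded_clique k p.+2) ->
  p.+2 + #|clique_edge p.+2| * k <= K ->
  e0 \in G -> x \in e0 -> y \in e0 -> x != y -> [disjoint Q & e0] -> #|Q| = p ->
  clique (heavy G K) Q -> {in Q, forall q, heavy G K x q && heavy G K y q} -> False.
Proof.
move=> k1 Gk + hK e0G xe ye xy Qe Qp Qc Qxy; apply/negP; rewrite negbK.
pose C := x |: (y |: Q).
have nQ u : u \in e0 -> u \notin Q.
  by move=> ue; apply: contraTN ue => uQ; rewrite (disjointFr Qe uQ).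
have cC : #|C| = p.+2 by rewrite !cardsU1 !inE negb_or xy !nQ // Qp.
pose z (i : 'I_p.+2) := enum_val (cast_ord (esym cC) i).
have zi : injective z by move=> i j /enum_val_inj /cast_ord_inj.
have zC i : z i \in C by apply: enum_valP.
have zs u : u \in C -> exists i, z i = u.
  move=> uC; exists (cast_ord cC (enum_rank_in uC u)).
  by rewrite /z cast_ordK enum_rankK_in.
have [i zx] := zs x (setU11 _ _).
have [j zy] : exists j, z j = y by apply: zs; rewrite !inE eqxx orbT.
have ij : i != j by apply: contraNneq xy => ij; rewrite -zx -zy ij.
have A0P : #|[set i; j]| == 2 by rewrite cards2 ij.
pose A0 : clique_edge p.+2 := exist (fun A : {set 'I_p.+2} => #|A| == 2) _ A0P.
have zA0 : z @: val A0 = [set x; y] by rewrite /= imsetU1 imset_set1 zx zy.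
have hv u v : u \in C -> v \in C -> u != v -> [set u; v] != [set x; y] -> heavy G K u v.
  rewrite !inE => /or3P[/eqP->|/eqP->|uQ] /or3P[/eqP->|/eqP->|vQ]; rewrite ?eqxx //.
  - by have /andP[] := Qxy v vQ.
  - by rewrite setUC eqxx.
  - by have /andP[] := Qxy v vQ.
  - by rewrite heavy_sym; have /andP[] := Qxy u uQ.
  - by rewrite heavy_sym; have /andP[] := Qxy u uQ.
  - by move=> uv _; apply: (cliqueP _ _ Qc).
have [|||||F [FG FC FF]] := @greedy_edges (clique_edge p.+2) k K G C (fun A => z @: val A) A0 e0 Gk.
- by move=> A; apply/subsetP => _ /imsetP[t _ ->].
- exact: e0G.
- rewrite zA0; apply/setP => u; rewrite !inE; case uQ: (u \in Q).
    have /negbTE -> : u \notin e0 by apply: contraTN uQ => /nQ.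
    apply/esym/negbTE; rewrite negb_or.
    by apply/andP; split; apply/eqP => eu; have := nQ u; rewrite uQ eu ?xe ?ye => /(_ isT).
  case: (u =P x) => [->|_] /=; first by rewrite xe.
  by case: (u =P y) => [->|_]; rewrite ?ye ?andbF.
- move=> A W AA0 WK AW; have /cards2P[u [v [uv Auv]]] := valP A.
  have Az : z @: val A = [set z u; z v] by rewrite Auv imsetU1 imset_set1.
  have huv : heavy G K (z u) (z v).
    apply: hv => //; first by apply: contraNneq uv => /zi ->.
    rewrite -Az -zA0; apply: contraNneq AA0 => /(imset_inj zi) eA.
    exact/eqP/val_inj.
  have nW t : t \in val A -> z t \notin W.
    by move=> tA; rewrite (disjointFr AW) ?imset_f.
  have uA : u \in val A by rewrite Auv !inE eqxx.
  have vA : v \in val A by rewrite Auv !inE eqxx orbT.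
  have Aor t : t \in val A -> (t == u) || (t == v) by rewrite Auv !inE.
  have [g [gG ug vg gW]] := heavyP huv WK (nW u uA) (nW v vA).
  by exists g; split=> //; apply/subsetP => _ /imsetP[t /Aor /orP[] /eqP-> ->].
- by rewrite cC.
exact: (@contains_expanded_clique k p.+2 x G C z F).
Qed.

Lemma heavy_clique_free k p K G :
  1 < k -> {in G, forall g, #|g| = k} ->
  ~~ contains (Hypergraph G) (expanded_clique k p.+2) ->
  p.+2 + #|clique_edge p.+2| * k <= K ->
  forall S, cliques (heavy G K) p.+2 S = set0.
Proof.
move=> k1 Gk nG hK S; apply/eqP/set0Pn => -[A /cliquesP[_ Ac /cliqueP Acl]].
have /card_gt0P[x xA] : 0 < #|A| by rewrite Ac.
have /card_gt0P[y] : 0 < #|A :\ x| by move: Ac; rewrite (cardsD1 x) xA add1n => -[->].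
case/setD1P => yx yA; pose Q := A :\ x :\ y.
have QA : Q \subset A by rewrite (subset_trans (subD1set _ _)) ?subD1set.
have Qp : #|Q| = p.
  by move: Ac; rewrite (cardsD1 x A) xA (cardsD1 y (A :\ x)) !inE yx yA => -[].
have xy : x != y by rewrite eq_sym.
have hxy := Acl x y xA yA xy.
have xQ : x \notin Q by rewrite !inE eqxx andbF.
have yQ : y \notin Q by rewrite !inE eqxx.
have QK : #|Q| <= K by rewrite Qp; apply: leq_trans hK; rewrite -addn2 -addnA leq_addr.
(* Heaviness of one pair, with the rest of the clique as the set to avoid, supplies the covering
   edge. *)
have [g [gG xg yg gQ]] := heavyP hxy QK xQ yQ.
apply: (heavy_clique_covered k1 Gk nG hK gG xg yg _ _ Qp).
- by rewrite eq_sym.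
- by rewrite disjoint_sym.
- by apply: cliqueS QA _; apply/cliqueP.
- move=> q; rewrite !inE => /and3P[qy qx qA].
  by rewrite !Acl // eq_sym.
Qed.
End Expansion.

Lemma bin_leq_expn n m : 'C(n, m) <= n ^ m.
Proof.
apply: leq_trans (_ : n ^_ m <= _); first by rewrite -bin_ffact leq_pmulr ?fact_gt0.
rewrite ffact_prod -[X in _ <= _ ^ X]card_ord -prod_nat_const.
by apply: leq_prod => i _; apply: leq_subr.
Qed.

(** * Edges with light pairs, colour classes and vertex degrees *)

Section Counting.

Variable V : finType.
Implicit Types (e : rel V) (G F : {set {set V}}) (A S W X D Q g : {set V}) (x y u v w : V).

Lemma card_supersets F A k : {in F, forall g, #|g| = k} -> {in F, forall g, A \subset g} ->
  #|F| <= #|V| ^ (k - #|A|).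
Proof.
move=> Fk FA; apply: leq_trans (bin_leq_expn _ _).
rewrite -card_draws -[X in X <= _](@card_in_imset _ _ (fun g => g :\: A) F).
  apply/subset_leq_card/subsetP => _ /imsetP[g gF ->].
  by rewrite inE cardsD (setIidPr (FA g gF)) Fk.
by move=> g h gF hF /= gh; rewrite -(setID g A) -(setID h A) gh !(setIidPr (FA _ _)).
Qed.

(** A set [W] witnessing lightness meets every edge through [x] and [y], and fixing the vertex met
    leaves [k - 3] free vertices. *)
Lemma card_light_pair G K k x y : {in G, forall g, #|g| = k} -> x != y ->
  ~~ heavy G K x y -> #|[set g in G | (x \in g) && (y \in g)]| <= K * #|V| ^ (k - 3).
Proof.
move=> Gk xy; rewrite /heavy xy /= => /forallPn[W].
rewrite negb_imply -!andbA => /and4P[WK xW yW nW].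
apply: leq_trans (card_hitting (W := W) _) _.
  move=> g; rewrite inE => /and3P[gG xg yg]; apply: contra nW => gW.
  by apply/exists_inP; exists g; rewrite // xg yg.
apply: leq_trans (_ : \sum_(w in W) #|V| ^ (k - 3) <= _); last first.
  by rewrite sum_nat_const leq_mul2r WK orbT.
apply: leq_sum => w wW; have -> : 3 = #|w |: [set x; y]|.
  rewrite cardsU1 cards2 xy !inE negb_or.
  by rewrite (memPn xW) // (memPn yW).
apply: card_supersets => g; rewrite !inE => /andP[/and3P[gG xg yg] wg]; first exact: Gk.
by apply/subsetP => v; rewrite !inE => /or3P[] /eqP->.
Qed.

Lemma card_light_at G K k u : {in G, forall g, #|g| = k} -> 2 < k ->
  #|[set g in G | (u \in g) && [exists v in g, (v != u) && ~~ heavy G K u v]]|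
    <= K * #|V| ^ (k - 2).
Proof.
move=> Gk k2; set F := finset _.
apply: leq_trans (card_hitting (F := F) (W := [set v | (v != u) && ~~ heavy G K u v]) _) _.
  move=> g; rewrite inE => /and3P[_ _ /exists_inP[v vg hv]].
  by apply/pred0Pn; exists v; rewrite /= vg inE.
have -> : k - 2 = (k - 3).+1 by lia.
rewrite expnS mulnCA; set W := finset _.
apply: (@leq_trans (\sum_(v in W) K * #|V| ^ (k - 3))); last first.
  by rewrite sum_nat_const leq_mul2r max_card orbT.
apply: leq_sum => v; rewrite inE => /andP[vu hv].
apply: leq_trans (card_light_pair Gk _ hv); last by rewrite eq_sym.
by apply/subset_leq_card/subsetP => g; rewrite !inE => /andP[/and3P[-> -> _] ->].
Qed.

Lemma card_heavy_cliques G K k : {in G, forall g, #|g| = k} -> 2 < k ->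
  #|G| <= #|cliques (heavy G K) k [set: V]| + K * #|V| ^ (k - 1).
Proof.
move=> Gk k2; rewrite -(cardsID (cliques (heavy G K) k setT) G).
apply: leq_add; first exact/subset_leq_card/subsetIr.
have -> : k - 1 = (k - 2).+1 by lia.
rewrite expnS mulnCA -[X in X * _]cardsT -sum_nat_const.
pose F x := [set g in G | (x \in g) && [exists v in g, (v != x) && ~~ heavy G K x v]].
apply: (@leq_trans (\sum_(x in [set: V]) #|F x|)); last first.
  by apply: leq_sum => x _; apply: card_light_at.
apply: leq_trans (leq_card_bigcup _ _).
apply/subset_leq_card/subsetP => g /setDP[gG ng].
have : ~~ clique (heavy G K) g.
  by apply: contra ng => gc; apply/cliquesP; split; rewrite ?subsetT ?Gk.
case/forall_inPn => x xg /forall_inPn[y yg]; rewrite negb_imply => /andP[xy hxy].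
apply/bigcupP; exists x => //; rewrite inE gG xg; apply/exists_inP; exists y => //.
by rewrite eq_sym xy.
Qed.

Lemma card_edges_hitting G k u X : {in G, forall g, #|g| = k} -> u \notin X ->
  #|[set g in G | (u \in g) && ~~ [disjoint g & X]]| <= #|X| * #|V| ^ (k - 2).
Proof.
move=> Gk uX; apply: leq_trans (card_hitting (W := X) _) _.
  by move=> g; rewrite inE => /and3P[].
rewrite -sum_nat_const; apply: leq_sum => w wX.
have <- : #|[set u; w]| = 2 by rewrite cards2; case: eqVneq uX => // ->; rewrite wX.
apply: card_supersets => g; rewrite !inE => /andP[/and3P[gG ug _] wg]; first exact: Gk.
by apply/subsetP => v; rewrite !inE => /orP[] /eqP->.
Qed.

(** A colour class lies in the non-neighbourhood of each of its vertices, so it has at most [a]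
    elements; the class [i] takes what the other [k] classes leave. *)
Lemma class_bound e S k c a (i : 'I_k.+1) : irreflexive e ->
  {in S, forall x, #|S :\: nb e S x| <= a} ->
  {in S &, forall x y, e x y -> c x != c y} ->
  #|S| <= #|[set x in S | c x == i]| + k * a.
Proof.
move=> ei ha hc; have cl j : #|[set x in S | c x == j]| <= a.
  have [->|[x]] := set_0Vmem [set x in S | c x == j]; first by rewrite cards0.
  rewrite inE => /andP[xS /eqP xj]; apply: leq_trans (ha x xS).
  apply/subset_leq_card/subsetP => y; rewrite !inE => /andP[yS /eqP yj].
  rewrite yS andbT /=; apply/negP => /(hc x y xS yS).
  by rewrite xj yj eqxx.
rewrite -sum1_card (partition_big c predT) //= (bigD1 i) //=.
apply: leq_add; first by rewrite sum1dep_card.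
apply: (@leq_trans (\sum_(j | j != i) a)); last first.
  by rewrite sum_nat_const cardC1 card_ord.
by apply: leq_sum => j _; rewrite sum1dep_card.
Qed.

(* Two vertices of one colour have about [#|S| - #|S| / (k + 1)] common heavy
   neighbours, enough for a greedy [k]-clique avoiding the edge [g]. *)
Lemma covered_pair_colour k K G S c (a : nat) :
  0 < k -> {in G, forall g, #|g| = k.+1} ->
  ~~ contains (Hypergraph G) (expanded_clique k.+1 k.+2) ->
  k.+2 + #|clique_edge k.+2| * k.+1 <= K ->
  {in S, forall x, #|S :\: nb (heavy G K) S x| <= a} ->
  {in S &, forall x y, heavy G K x y -> c x != c y :> 'I_k.+1} ->
  (2 * k + 1) * a + k.+1 < 2 * #|S| ->
  forall g x y, g \in G -> x \in g -> y \in g -> x \in S -> y \in S -> x != y -> c x != c y.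
Proof.
move=> k0 Gk nG hK ha hc hS g x y gG xg yg xS yS xy; apply/negP => /eqP cxy.
set e := heavy G K in ha hc.
have es : symmetric e := @heavy_sym _ G K; have ei : irreflexive e := @heavy_irr _ G K.
have := class_bound (c x) ei ha hc.
set C := [set z in S | c z == c x] => hC.
pose N := nb e S x :&: nb e S y.
have NS : N \subset S by rewrite (subset_trans (subsetIl _ _)) ?nb_sub.
have NC z : z \in S -> c z = c x -> nb e S z \subset S :\: C.
  move=> zS cz; apply/subsetP => w; rewrite !inE => /andP[wS ezw]; rewrite wS andbT /=.
  by have := hc z w zS wS ezw; rewrite cz eq_sym.
have CS : C \subset S by apply/subsetP => w; rewrite inE => /andP[].
(* Both neighbourhoods avoid [C], so by inclusion-exclusion they share at least
   [2 * #|S| - (k + 2) * a] vertices; removing [g] costs at most [k.+1] more. *)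
have big : (k - 1) * a < #|N :\: g|.
  have hx := ha x xS; have hy := ha y yS.
  rewrite cardsD (setIidPr (nb_sub _ _ _)) in hx.
  rewrite cardsD (setIidPr (nb_sub _ _ _)) in hy.
  have xC := NC x xS erefl; have yC := NC y yS (esym cxy).
  have hU : #|nb e S x :|: nb e S y| <= #|S| - #|C|.
    have := cardsID C S; rewrite (setIidPr CS) => <-.
    by rewrite addKn subset_leq_card // subUset xC yC.
  have h1 := cardsUI (nb e S x) (nb e S y); rewrite -/N in h1.
  have h2 : #|N :&: g| <= k.+1 by rewrite -(Gk g gG) subset_leq_card ?subsetIr.
  have h3 := cardsID g N;
  nia.
have NgS : N :\: g \subset S by rewrite (subset_trans (subsetDl _ _)).
have /set0Pn[Q /cliquesP[QN Qk Qc]] := greedy_clique es ei ha NgS big.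
have {}Qk : #|Q| = k by rewrite Qk; lia.
apply: (@heavy_clique_covered _ k.+1 k K G g x y Q) => //.
  apply/pred0P => z /=; apply/negbTE/andP => -[/(subsetP QN)]; rewrite inE => /andP[/negbTE -> //].
by move=> q /(subsetP QN); rewrite !inE => /and3P[_ /andP[_ h1] /andP[_ h2]]; apply/andP.
Qed.

(** Vertices are picked with colours 0, 1, ... in turn. The new colour differs from all earlier
    ones, so each earlier vertex excludes at most [b] candidates of it. *)
Lemma transversal_clique e D k b (c : V -> 'I_k) : symmetric e ->
  {in D, forall z, #|[set w in D | (c w != c z) && ~~ e z w]| <= b} ->
  (forall i, k * b < #|[set w in D | c w == i]|) -> cliques e k D != set0.
Proof.
move=> es hb hD.
suff main j : j <= k -> exists2 A, A \in cliques e j D & {in A, forall x, c x < j}.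
  by have [A AC _] := main k (leqnn k); apply/set0Pn; exists A.
elim: j => [_|j IHj jk].
  by exists set0; rewrite ?cliques0 ?inE // => x; rewrite inE.
have [A /cliquesP[AD Aj Ac] Acol] := IHj (ltnW jk).
pose B := \bigcup_(z in A) [set w in D | (c w != c z) && ~~ e z w].
have cB : #|B| <= k * b.
  apply: leq_trans (leq_card_bigcup _ _) _.
  apply: (@leq_trans (\sum_(z in A) b)).
    by apply: leq_sum => z zA; apply/hb/(subsetP AD).
  by rewrite sum_nat_const Aj leq_mul2r ltnW ?orbT.
have /subsetPn[w] : ~~ ([set w in D | c w == Ordinal jk] \subset B).
  by apply: contraTN (hD (Ordinal jk)) => /subset_leq_card h; rewrite -leqNgt (leq_trans h).
rewrite inE => /andP[wD /eqP cw] wB.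
have ew : {in A, forall z, e w z}.
  move=> z zA; apply: contraR wB => nwz; apply/bigcupP; exists z => //.
  rewrite inE wD es nwz andbT cw -val_eqE /= neq_ltn.
  by rewrite (Acol z zA) orbT.
have wA : w \notin A by apply/negP => /Acol; rewrite cw ltnn.
exists (w |: A).
  apply/cliquesP; split; first by rewrite subUset sub1set wD.
    by rewrite cardsU1 wA Aj.
  exact: cliqueU1.
by move=> x /setU1P[->|/Acol xj]; [rewrite cw|apply: leqW].
Qed.

(* The edges at [u] are those containing a light pair at [u], those leaving
   [S0] or meeting the heavy neighbourhood of [u] in a colour [i] where it is
   small, and those whose remaining [k] vertices form a rainbow subset, avoiding
   the colour [i], of the heavy neighbourhood of [u]. *)
Lemma degree_bound k K G S0 c (a0 : nat) u (b := k.+1 * a0 - #|S0|) :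
  1 < k -> {in G, forall g, #|g| = k.+1} ->
  ~~ contains (Hypergraph G) (expanded_clique k.+1 k.+2) ->
  k.+2 + #|clique_edge k.+2| * k.+1 <= K ->
  {in S0, forall x, #|S0 :\: nb (heavy G K) S0 x| <= a0} ->
  (forall g x y, g \in G -> x \in g -> y \in g -> x \in S0 -> y \in S0 -> x != y ->
     c x != c y :> 'I_k.+1) ->
  #|[set g in G | u \in g]| * k ^ k <=
    (K + (#|V| - #|S0|) + k.+1 * b) * #|V| ^ (k - 1) * k ^ k
    + #|nb (heavy G K) [set: V] u| ^ k.
Proof.
move=> k1 Gk nG hK ha hc; set e := heavy G K in ha *.
have es : symmetric e := @heavy_sym _ G K; have ei : irreflexive e := @heavy_irr _ G K.
have hce : {in S0 &, forall x y, e x y -> c x != c y}.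
  move=> x y xS yS exy; have [|||g [gG xg yg _]] := @heavyP _ G K x y set0 exy.
  - by rewrite cards0.
  - by rewrite inE.
  - by rewrite inE.
  by apply: (hc g) => //; apply: contraTneq exy => ->; rewrite ei.
have ea0 : cliques e k.+2 [set: V] = set0 by apply: (@heavy_clique_free _ k.+1) => //; apply: ltnW.
pose D := nb e S0 u; pose Di i := [set w in D | c w == i].
(* The class of [z] consists of non-neighbours of [z] and has at least [#|S0| - k * a0] vertices; of
   at most [a0] non-neighbours, this leaves at most [b] in other colours. *)
have hb : {in S0, forall z, #|[set w in S0 | (c w != c z) && ~~ e z w]| <= b}.
  move=> z zS; have h1 := class_bound (c z) ei ha hce; have h2 := ha z zS.
  have h3 : #|[set w in S0 | (c w != c z) && ~~ e z w]| + #|[set w in S0 | c w == c z]|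
      <= #|S0 :\: nb e S0 z|.
    rewrite -cardsUI; set I := _ :&: _; have -> : I = set0.
      by apply/setP => w; rewrite !inE; case: (c w == c z); rewrite ?andbF.
    rewrite cards0 addn0; apply/subset_leq_card/subsetP => w; rewrite !inE.
    case wS: (w \in S0) => //= /orP[/andP[_ ->]//|cwz]; rewrite andbT.
    by apply: contraTN cwz => ezw; rewrite eq_sym; apply: hce.
  rewrite /b; lia.
(* Otherwise [D] would contain a rainbow heavy clique, which together with [u] would have [k.+2]
   vertices. *)
have [i hi] : exists i, #|Di i| <= k.+1 * b.
  apply/existsP; apply: contraT => /existsPn hD.
  have : cliques e k.+1 D != set0.
    apply: (@transversal_clique e D k.+1 b c) => // [z|i]; last by rewrite ltnNge hD.
    rewrite inE => /andP[zS _]; apply: leq_trans (hb z zS); apply/subset_leq_card/subsetP => w.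
    by rewrite !inE => /andP[/andP[-> _] ->].
  have DT : D \subset nb e setT u by apply/subsetP => w; rewrite !inE => /andP[].
  by rewrite (cliques_eq0S DT (cliques_nb_eq0 es ei (in_setT u) ea0)) eqxx.
pose X := (~: S0 :\ u) :|: Di i.
have uX : u \notin X by rewrite !inE eqxx ei !andbF.
have cX : #|X| <= #|V| - #|S0| + k.+1 * b.
  rewrite cardsU; apply: leq_trans (leq_subr _ _) (leq_add _ hi).
  by rewrite -(cardsC S0) addKn subset_leq_card ?subD1set.
have cK := card_light_at K u Gk k1.
have cH := card_edges_hitting Gk uX.
(* Zykov's bound is applied to the graph joining vertices of different colours: once the colour [i]
   is removed it has no [k.+1]-clique, and its [k]-cliques are the rainbow sets. *)
pose e' : rel V := fun x y => c x != c y.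
have e's : symmetric e' by move=> x y; rewrite /e' eq_sym.
have e'i : irreflexive e' by move=> x; rewrite /e' eqxx.
have e'0 : cliques e' k.+1 (D :\: Di i) = set0.
  apply/eqP/set0Pn => -[A /cliquesP[AD Ak /cliqueP Ac]].
  have : #|c @: A| <= #|[set~ i]|.
    apply/subset_leq_card/subsetP => _ /imsetP[x /(subsetP AD) + ->].
    by rewrite !inE => /andP[nx xD]; apply: contra nx => ->; rewrite xD.
  rewrite card_in_imset ?Ak; last first.
    by move=> x y xA yA cxy; apply/eqP; apply: contraT => /(Ac x y xA yA); rewrite /e' cxy eqxx.
  by rewrite cardsC1 card_ord ltnn.
have zyk := zykov e's e'i e'0.
pose F1 := [set g in G | (u \in g) && [exists v in g, (v != u) && ~~ heavy G K u v]].
pose F2 := [set g in G | (u \in g) && ~~ [disjoint g & X]].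
pose F3 := [set g in G | u \in g] :\: (F1 :|: F2).
have cF3 : #|F3| <= #|cliques e' k (D :\: Di i)|.
  apply: (@card_le_setU1 _ _ _ u) => g; rewrite !inE negb_or => /andP[/andP[]];
    case gG: (g \in G) => //=; case ug: (u \in g) => //= n1 n2 _.
  have heavyu v : v \in g -> v != u -> e u v.
    by move=> vg vu; apply: contraNT n1 => nv; apply/exists_inP; exists v; rewrite // vu.
  have nX v : v \in g -> v \notin X.
    by move=> vg; apply: contraNN n2 => vX; apply/pred0Pn; exists v; rewrite /= vg.
  have S0g v : v \in g -> v != u -> v \in S0.
    by move=> vg vu; move: (nX v vg); rewrite !inE vu /= negb_or negbK => /andP[].
  have gk := Gk g gG; rewrite (cardsD1 u) ug in gk; case: gk => gk.
  apply/and3P; split; last 1 first.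
  - apply/cliqueP => x y /setD1P[xu xg] /setD1P[yu yg] xy.
    by apply: (hc g) => //; apply: S0g.
  - apply/subsetP => v /setD1P[vu vg]; rewrite in_setD.
    have := nX v vg; rewrite in_setU negb_or => /andP[_ ->].
    by rewrite inE S0g //= heavyu.
  - exact/eqP.
have cF : #|[set g in G | u \in g]| <= #|F1| + #|F2| + #|F3|.
  rewrite -(cardsID (F1 :|: F2) [set g in G | u \in g]) leq_add2r.
  apply: leq_trans (_ : #|F1 :|: F2| <= _); first exact/subset_leq_card/subsetIr.
  by rewrite cardsU leq_subr.
have cD : #|D :\: Di i| ^ k <= #|nb e [set: V] u| ^ k.
  rewrite leq_exp2r ?(ltnW k1) //; apply/subset_leq_card/subsetP => w; rewrite !inE.
  by case/and3P.
have -> : k - 1 = k.+1 - 2 by lia.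
apply: leq_trans (leq_mul cF (leqnn _)) _; rewrite mulnDl; apply: leq_add.
  rewrite leq_mul2r; apply/orP; right; rewrite -addnA [X in _ <= X]mulnDl.
  by apply: leq_add => //; apply: leq_trans cH _; rewrite leq_mul2r cX orbT.
by apply: leq_trans cD; apply: leq_trans zyk; rewrite leq_mul2r cF3 orbT.
Qed.
End Counting.

Lemma eqn_mod_subn n X X' : X < n -> X' < n -> n - X = n - X' %[mod n] -> X = X'.
Proof.
move=> Xn X'n /eqP; rewrite -(eqn_modDr (X + X')) addnA subnK; last exact: ltnW.
rewrite [X + X']addnC addnA subnK; last exact: ltnW.
by rewrite !modnDl !modn_small // => /eqP.
Qed.

Lemma leq_card_fibers (T U : finType) (F : {set T}) (f : T -> U) (P : pred U) m :
  {in F, forall x, P (f x)} -> (forall y, #|[set x in F | f x == y]| <= m) ->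
  #|F| <= #|P| * m.
Proof.
move=> hP hm; rewrite -sum1_card (partition_big f P) //= -sum_nat_const.
by apply: leq_sum => y _; rewrite sum1dep_card.
Qed.

(** * Matchings in partite hypergraphs *)

Section Partite.

Variable V : finType.
Implicit Types (F M : {set {set V}}) (S g : {set V}) (x y z : V).

(* The edges of the complete multipartite hypergraph split into
   [\prod_(i | i != i0) n i] matchings, according to the cyclic offsets of their
   vertices in the classes [i != i0] relative to the vertex in the class [i0]. *)
Lemma partite_matching_bound k s S F (c : V -> 'I_k) (i0 : 'I_k)
    (n := fun i => #|[set x in S | c x == i]|) :
  {in F, forall g, [/\ g \subset S, #|g| = k & {in g &, injective c}]} ->
  (forall M, M \subset F -> trivIset M -> #|M| <= s) ->
  (forall i, n i0 <= n i) ->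
  #|F| <= minn s (n i0) * \prod_(i | i != i0) n i.
Proof.
move=> hF hM hmin.
have [->|[g0 g0F]] := set_0Vmem F; first by rewrite cards0.
have k0 : 0 < k := leq_ltn_trans (leq0n _) (ltn_ord i0).
have [x0 x0g] : exists x0, x0 \in g0.
  by have [_ gk _] := hF g0 g0F; apply/card_gt0P; rewrite gk.
have colP g i : g \in F -> exists2 x, x \in g & c x = i.
  move=> /hF [_ gk ci]; have : i \in c @: g; last by case/imsetP => x xg ->; exists x.
  suff -> : c @: g = setT by rewrite inE.
  by apply/eqP; rewrite eqEcard subsetT cardsT card_ord card_in_imset // gk leqnn.
pose pt g i := odflt x0 [pick x in g | c x == i].
have ptP g i : g \in F -> pt g i \in g /\ c (pt g i) = i.
  move=> gF; rewrite /pt; case: pickP => [x /andP[xg /eqP]//|no].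
  by have [x xg cx] := colP g i gF; have := no x; rewrite xg cx eqxx.
have ptE g x : g \in F -> x \in g -> pt g (c x) = x.
  move=> gF xg; have [pg cp] := ptP g (c x) gF; have [_ _ ci] := hF g gF.
  exact: ci.
pose C i := [set x in S | c x == i].
pose pos i x := index x (enum (C i)).
have ptC g i : g \in F -> pt g i \in C i.
  move=> gF; have [pg cp] := ptP g i gF; have [gS _ _] := hF g gF.
  by rewrite inE (subsetP gS) // cp eqxx.
have posn g i : g \in F -> pos i (pt g i) < n i.
  by move=> gF; rewrite /pos /n cardE index_mem mem_enum ptC.
have posI g h i : g \in F -> h \in F -> pos i (pt g i) = pos i (pt h i) -> pt g i = pt h i.
  move=> gF hF' eq; have := congr1 (nth x0 (enum (C i))) eq.
  by rewrite !nth_index ?mem_enum ?ptC.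
(* As [n i0 <= n i], the subtraction is not truncated and positions in the class [i0] stay distinct
   modulo [n i]: the offset and the vertex in the class [i] determine the vertex in the class
   [i0]. *)
pose off g i := (pos i (pt g i) + (n i - pos i0 (pt g i0))) %% n i.
have n0 i : 0 < n i by apply: leq_ltn_trans (posn g0 i g0F).
(* The constant value [x0] at [i0] makes the target a product over the other classes only; the
   fibres are the matchings. *)
pose phi g : {ffun 'I_k -> V} :=
  [ffun i => if i == i0 then x0 else nth x0 (enum (C i)) (off g i)].
pose Fam i : pred V := if i == i0 then pred1 x0 else mem (C i).
have -> : \prod_(i | i != i0) n i = #|family Fam|.
  rewrite card_family foldrE big_image /= [RHS](bigD1 i0) //= /Fam eqxx card1 mul1n.
  by apply: eq_bigr => i /negbTE ->.
rewrite mulnC; apply: (leq_card_fibers (f := phi)) => [g gF|t].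
  apply/familyP => i; rewrite ffunE /Fam; case: eqP => _; first by rewrite inE.
  have : off g i < size (enum (C i)) by rewrite -cardE ltn_mod n0.
  by move/(mem_nth x0); rewrite mem_enum.
set M := finset _.
have offE g h i : g \in M -> h \in M -> i != i0 -> off g i = off h i.
  rewrite !inE => /andP[gF /eqP gt] /andP[hF' /eqP ht] ii0.
  have : phi g i = phi h i by rewrite gt ht.
  rewrite !ffunE (negbTE ii0) => /eqP; rewrite nth_uniq ?enum_uniq -?cardE ?ltn_mod ?n0 //.
  by move/eqP.
have MF g : g \in M -> g \in F by rewrite inE => /andP[].
have pt0 g h : g \in M -> h \in M -> pt g i0 = pt h i0 -> g = h.
  move=> gM hM' e0; have gF := MF _ gM; have hF' := MF _ hM'.
  have e i : pt g i = pt h i.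
    have [->//|ii0] := eqVneq i i0; have := offE g h i gM hM' ii0.
    rewrite /off e0 => /eqP; rewrite eqn_modDr !modn_small ?posn // => /eqP.
    exact: posI.
  apply/setP => x; apply/idP/idP => xg.
    by have := (ptP h (c x) hF').1; rewrite -e ptE.
  by have := (ptP g (c x) gF).1; rewrite e ptE.
rewrite leq_min; apply/andP; split; last first.
  rewrite -(card_in_imset (f := fun g => pt g i0)) => [|g h gM hM']; last exact: pt0.
  by apply/subset_leq_card/subsetP => _ /imsetP[g /MF gF ->]; apply: ptC.
apply: hM; first by apply/subsetP.
apply/trivIsetP => g h gM hM'; apply: contraNT => /pred0Pn[x /andP[/= xg xh]].
have [gF hF'] := (MF _ gM, MF _ hM').
apply/eqP/pt0 => //; have [eq|ii0] := eqVneq (c x) i0.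
  by rewrite -eq !ptE.
apply: posI => //; have := offE g h (c x) gM hM' ii0.
rewrite /off !ptE // => /eqP; rewrite eqn_modDl => /eqP; apply: eqn_mod_subn.
  by apply: leq_trans (hmin _); apply: posn.
by apply: leq_trans (hmin _); apply: posn.
Qed.
End Partite.

Lemma matching_bound (V : finType) (F M : {set {set V}}) k s : 0 < k ->
  {in F, forall g : {set V}, #|g| = k} -> ~~ contains (Hypergraph F) (matching k s.+1) ->
  M \subset F -> trivIset M -> #|M| <= s.
Proof.
move=> k0 Fk nF MF /trivIsetP tM; rewrite leqNgt; apply: contra nF => sM.
have gM (i : 'I_s.+1) : nth set0 (enum M) i \in M.
  by rewrite -mem_enum mem_nth // -cardE (leq_trans (ltn_ord i)).
set E := nth set0 (enum M) in gM.
have gk i : i < s.+1 -> size (enum (E i)) = k.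
  by move=> si; rewrite -cardE Fk // (subsetP MF) // (gM (Ordinal si)).
have /card_gt0P[x0 _] : 0 < #|E 0| by rewrite cardE gk.
pose f (t : 'I_s.+1 * 'I_k) : V := nth x0 (enum (E t.1)) t.2.
have fE t : f t \in E t.1 by rewrite -mem_enum mem_nth // gk.
have fi : injective f.
  move=> [i j] [i' j'] eq; have ei : i = i'.
    apply/val_inj/eqP; apply: contraT => ii'.
    have dis : [disjoint E i & E i'].
      by apply: tM => //; rewrite /E nth_uniq ?enum_uniq // -cardE (leq_trans (ltn_ord _)).
    by have := fE (i, j); rewrite eq (disjointFl dis (fE (i', j'))).
  subst i'; congr (_, _); apply/val_inj/eqP; move/eqP: eq.
  by rewrite /f /= nth_uniq ?gk ?enum_uniq.
apply/existsP; exists [ffun t => f t]; apply/andP; split.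
  by apply/injectiveP => t t'; rewrite !ffunE; apply: fi.
apply/forall_inP => _ /imsetP[i _ ->] /=.
suff -> : [ffun t => f t] @: [set (i, j) | j : 'I_k] = E i by apply: (subsetP MF).
apply/eqP; rewrite eqEcard; apply/andP; split.
  by apply/subsetP => _ /imsetP[t /imsetP[j _ ->] ->]; rewrite ffunE; apply: fE.
rewrite card_imset; last by move=> t t'; rewrite !ffunE; apply: fi.
rewrite card_imset ?card_ord; last by move=> j j' [].
by rewrite cardE gk.
Qed.

(* The product of the part sizes of a balanced partition of [m] into [r] parts. *)
Definition balanced_prod m r := (m %/ r) ^ (r - m %% r) * (m %/ r).+1 ^ (m %% r).

(** The extra vertex goes to a smallest part, of size [m %/ r]; multiplying by this size avoids a
    division. *)
Lemma balanced_prodS m r : 0 < r ->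
  balanced_prod m.+1 r * (m %/ r) = balanced_prod m r * (m %/ r).+1.
Proof.
move=> r0; rewrite /balanced_prod modnS divnS //.
have mr := ltn_pmod m r0.
case: (boolP (r %| m.+1)) => dv.
  have em : (m %% r).+1 = r.
    apply/eqP; rewrite eqn_leq mr /= dvdn_leq //.
    by move: dv; rewrite /dvdn -addn1 -modnDml addn1.
  have -> : r - m %% r = 1 by lia.
  rewrite subn0 expn0 muln1 add1n expn1.
  have -> : (m %/ r).+1 ^ r = (m %/ r).+1 * (m %/ r).+1 ^ (m %% r) by rewrite -expnS em.
  by ring.
rewrite add0n expnS.
have ltr : (m %% r).+1 < r.
  rewrite ltn_neqAle mr andbT; apply: contraNneq dv => em.
  by rewrite /dvdn -addn1 -modnDml addn1 em modnn.
have -> : r - m %% r = (r - (m %% r).+1).+1 by lia.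
rewrite expnS; ring.
Qed.

Lemma balanced_prod_small m r : m < r -> balanced_prod m r = 0.
Proof.
move=> mr; rewrite /balanced_prod divn_small // modn_small // exp0n ?mul0n //.
by rewrite subn_gt0.
Qed.

Lemma balanced_prod_ge m r : (m %/ r) ^ r <= balanced_prod m r.
Proof.
case: (posnP r) => [->|r0]; first by rewrite /balanced_prod divn0 modn0 sub0n !expn0 mul1n expn_gt0.
have mr := ltn_pmod m r0.
rewrite /balanced_prod -{2}(subnK (ltnW mr)) expnD leq_mul2l .
apply/orP; right; case: (m %% r) => [|i]; first by [].
by rewrite leq_exp2r.
Qed.

(** Induction on the total, removing a vertex from a largest part [j]. Putting it back multiplies
    the product by [n j / (n j - 1)] and the balanced product by [(q + 1) / q], where [q] is the
    quotient of the reduced total; the latter factor is at least as large since [q < n j]. If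
    [q = 0] and no part is empty, all parts are singletons. *)
Lemma prod_le_balanced (I : finType) (P : pred I) (n : I -> nat) :
  \prod_(i | P i) n i <= balanced_prod (\sum_(i | P i) n i) #|P|.
Proof.
have [m] := ubnP (\sum_(i | P i) n i); elim: m n => // m IHm n sm.
have [j /andP[/= Pj /eqP nj0]|nz] := pickP [pred i | P i & n i == 0].
  by rewrite (bigD1 j) //= nj0 mul0n.
have n_gt0 i : P i -> 0 < n i by move=> Pi; have := nz i; rewrite /= Pi /= lt0n => ->.
have [j0 Pj0|P0] := pickP P; last first.
  by rewrite !big_pred0 // eq_card0.
have [j Pj nmax] := arg_maxnP n Pj0.
set r := #|P|; have r0 : 0 < r by apply/card_gt0P; exists j.
pose n' i := if i == j then (n j).-1 else n i.
pose X := \prod_(i | P i && (i != j)) n i; pose Y := \sum_(i | P i && (i != j)) n i.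
have pn : \prod_(i | P i) n i = n j * X by rewrite (bigD1 j).
have sn : \sum_(i | P i) n i = n j + Y by rewrite (bigD1 j).
have pn' : \prod_(i | P i) n' i = (n j).-1 * X.
  by rewrite (bigD1 j) //= /n' eqxx; congr (_ * _); apply: eq_bigr => i /andP[_ /negbTE ->].
have sn' : \sum_(i | P i) n' i = (n j).-1 + Y.
  by rewrite (bigD1 j) //= /n' eqxx; congr (_ + _); apply: eq_bigr => i /andP[_ /negbTE ->].
have nj0 := n_gt0 j Pj.
have rn : \sum_(i | P i) n i <= r * n j.
  by rewrite /r -sum_nat_const; apply: leq_sum => i; apply: nmax.
have := IHm n'; rewrite pn' sn' => IH.
rewrite pn sn in rn sm *.
have {}IH : (n j).-1 * X <= balanced_prod ((n j).-1 + Y) r by apply: IH; lia.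
have := balanced_prodS ((n j).-1 + Y) r0; rewrite -addSn prednK // => rec.
have qp : ((n j).-1 + Y) %/ r < n j by rewrite ltn_divLR // mulnC; lia.
case: (posnP (((n j).-1 + Y) %/ r)) => [q0|q0]; last first.
  rewrite -(leq_pmul2r q0) rec; apply: leq_trans (leq_mul IH (leqnn _)).
  rewrite mulnAC [X in _ <= X]mulnAC leq_mul2r; apply/orP; right.
  by move: qp; set q := _ %/ r; nia.
have Yr : r.-1 <= Y.
  have -> : r.-1 = \sum_(i | P i && (i != j)) 1.
    rewrite sum1_card /r (cardD1 j) unfold_in Pj /=.
    by apply: eq_card => i; rewrite !inE andbC.
  by apply: leq_sum => i /andP[/n_gt0].
have mr : (n j).-1 + Y < r by move: (divn_eq ((n j).-1 + Y) r); rewrite q0 => ->; rewrite ltn_mod.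
have nj1 : n j = 1 by lia.
have -> : X = 1.
  rewrite /X big1 // => i /andP[Pi _]; apply/eqP; rewrite eqn_leq n_gt0 // andbT -nj1.
  exact: nmax.
apply: leq_trans (balanced_prod_ge _ _); rewrite nj1 muln1.
have -> : 1 + Y = r by lia.
by rewrite divnn r0 exp1n.
Qed.

(** A new vertex adds the product of the other [r - 1] parts, each of size at least [m %/ r]. This
    gain pays for the vertices outside [S] in [edges_bound]. *)
Lemma balanced_prod_add m t r : 0 < r ->
  balanced_prod m r + t * (m %/ r) ^ (r - 1) <= balanced_prod (m + t) r.
Proof.
move=> r0; elim: t => [|t IHt]; first by rewrite mul0n !addn0.
rewrite addnS mulSn addnCA; apply: leq_trans (leq_add (leqnn _) IHt) _.
have mt : m %/ r <= (m + t) %/ r by rewrite leq_div2r // leq_addr.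
case: (posnP ((m + t) %/ r)) => [q0|q0].
  case: (ltnP 1 r) => r1.
    move: mt; rewrite q0 leqn0 => /eqP ->; rewrite exp0n ?add0n; last by lia.
    rewrite balanced_prod_small //.
    by move: (divn_eq (m + t) r); rewrite q0 => ->; rewrite ltn_mod.
  have -> : r = 1 by lia.
  by rewrite /balanced_prod !modn1 !divn1 !subn0 subnn !expn1 !expn0 !muln1 add1n.
have := balanced_prodS (m + t) r0; have := balanced_prod_ge (m + t) r.
set q := (m + t) %/ r in mt q0 *; set B := balanced_prod _ _; set B' := balanced_prod _ _.
move=> qB rec; rewrite -(leq_pmul2r q0) rec mulnDl mulnS leq_add2r.
apply: leq_trans qB; rewrite -[X in q ^ X](subnK r0) expnD expn1 leq_mul2r.
by apply/orP; right; case: (r - 1) => // i; rewrite leq_exp2r.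
Qed.

Lemma balanced_prod_mono m m' r : 0 < r -> m <= m' ->
  balanced_prod m r <= balanced_prod m' r.
Proof.
move=> r0 /subnKC <-; apply: leq_trans (balanced_prod_add _ _ r0).
exact: leq_addr.
Qed.

(** Passing from [s] to [s.+1] multiplies the first factor by [(s + 1) / s] and the second by
    [q / (q + 1)] with [q = (n - s.+1) %/ r]; the last hypothesis ensures [s < q]. *)
Lemma mul_balanced_prod_mono n y s r : 0 < r -> y <= s -> r.+1 * s <= n ->
  y * balanced_prod (n - y) r <= s * balanced_prod (n - s) r.
Proof.
move=> r0; elim: s => [|s IHs]; first by rewrite leqn0 => /eqP ->.
rewrite leq_eqVlt => /predU1P[->//|ys] hn.
apply: leq_trans (IHs ys _) _; first by apply: leq_trans hn; rewrite leq_mul2l ltnW ?orbT.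
have := balanced_prodS (n - s.+1) r0.
have -> : (n - s.+1).+1 = n - s by nia.
have sq : s.+1 <= (n - s.+1) %/ r by rewrite leq_divRL //; nia.
set q := _ %/ r in sq *; set B := balanced_prod _ _; set B' := balanced_prod _ _ => rec.
have q0 : 0 < q by apply: leq_trans sq.
rewrite -(leq_pmul2r q0) -mulnA rec mulnCA [X in _ <= X]mulnAC [X in _ <= X]mulnC leq_mul2l.
by apply/orP; right; nia.
Qed.

(** * The extremal construction *)

Lemma card_turan_part_ge m r j : j < r -> m %/ r + (j < m %% r) <= #|turan_part m r j|.
Proof.
move=> jr; have r0 : 0 < r by apply: leq_ltn_trans jr.
have lt_m t : t < m %/ r + (j < m %% r) -> t * r + j < m.
  have := divn_eq m r; case: (ltnP j (m %% r)) => jm; nia.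
pose h (t : 'I_(m %/ r + (j < m %% r))) := Ordinal (lt_m t (ltn_ord t)).
have hi : injective h.
  move=> t t' /(congr1 val) /= /eqP; rewrite eqn_add2r eqn_mul2r.
  by rewrite -[r == 0]negbK -lt0n r0 /= => /eqP /val_inj.
rewrite -[X in X <= _]card_ord -(card_imset _ hi).
apply/subset_leq_card/subsetP => _ /imsetP[t _ ->].
by rewrite inE /= modnMDl modn_small.
Qed.

(** Choosing one vertex in each residue class gives distinct edges. The inequality turns the upper
    bound, proved with [balanced_prod], into one that meets [ex_number_ge]. *)
Lemma turan_number_ge m r : 0 < r -> balanced_prod m r <= turan_number r m r.
Proof.
move=> r0; pose Fam (j : 'I_r) : pred 'I_m := mem (turan_part m r j).
have le1 : balanced_prod m r <= #|family Fam|.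
  rewrite card_family foldrE big_image /=.
  apply: (@leq_trans (\prod_(j < r) (m %/ r + (j < m %% r)))); last first.
    by apply: leq_prod => j _; apply: card_turan_part_ge.
  rewrite -(big_mkord xpredT (fun j => m %/ r + (j < m %% r))).
  have mr := ltnW (ltn_pmod m r0); rewrite (big_cat_nat (n := m %% r)) //= /balanced_prod mulnC.
  rewrite (eq_big_nat _ _ (F2 := fun=> (m %/ r).+1)) => [|j /andP[_ ->]]; last by rewrite addn1.
  rewrite [\prod_(m %% r <= j < r) _](eq_big_nat _ _ (F2 := fun=> m %/ r)) => [|j /andP[jm _]]; last first.
    by rewrite ltnNge jm addn0.
  by rewrite !prod_nat_const_nat subn0.
apply: leq_trans le1 _.
have famP (f : {ffun 'I_r -> 'I_m}) : f \in family Fam -> forall j, f j %% r = j.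
  by move=> /familyP fF j; have := fF j; rewrite /Fam inE => /eqP.
have fi (f : {ffun 'I_r -> 'I_m}) : f \in family Fam -> injective f.
  move=> fF i j eq; apply: val_inj; rewrite /= -(famP f fF i) -(famP f fF j).
  by rewrite eq.
rewrite -(card_in_imset (f := fun f : {ffun 'I_r -> 'I_m} => f @: setT)); last first.
  move=> f g fF gF eq; apply/ffunP => j.
  have : f j \in g @: setT by rewrite -eq imset_f.
  case/imsetP => i _ eqi; have := famP f fF j; rewrite eqi (famP g gF i) => ij.
  by congr (g _); apply: val_inj.
apply/subset_leq_card/subsetP => _ /imsetP[f fF ->]; rewrite inE.
rewrite card_imset ?cardsT ?card_ord ?eqxx; last exact: fi.
apply/forallP => j; apply/card_le1_eqP => x y.
rewrite !inE => /andP[/imsetP[i _ ->] /eqP ei] /andP[/imsetP[i' _ ->] /eqP ei'].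
by congr (f _); apply: val_inj; rewrite /= -(famP f fF i) -(famP f fF i') ei ei'.
Qed.

Section LowerBound.

Variables k s m : nat.
Hypothesis k1 : 0 < k.

Definition join_edge (p : 'I_s * {set 'I_m}) : {set 'I_(s + m)} :=
  lshift m p.1 |: (@rshift s m @: p.2).

Definition join_edges : {set {set 'I_(s + m)}} :=
  [set join_edge p | p in setX setT (edges (turan k m k))].

Lemma mem_join_edgel p x : (lshift m x \in join_edge p) = (x == p.1).
Proof.
rewrite !inE (inj_eq (@lshift_inj _ _)) orbC; case: imsetP => [[y _ eq]|//].
by have := eq_lrshift x y; rewrite eq eqxx.
Qed.

Lemma mem_join_edger p y : (rshift s y \in join_edge p) = (y \in p.2).
Proof.
by rewrite !inE eq_rlshift /= mem_imset //; apply: rshift_inj.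
Qed.

Lemma card_join_edges : #|join_edges| = s * turan_number k m k.
Proof.
rewrite card_in_imset ?cardsX ?cardsT ?card_ord // => p q _ _ eq.
have e1 : p.1 = q.1 by apply/eqP; rewrite -mem_join_edgel -eq mem_join_edgel.
have e2 : p.2 = q.2 by apply/setP => y; rewrite -!mem_join_edger eq.
by case: p q {eq} e1 e2 => [? ?] [? ?] /= -> ->.
Qed.

Definition join_colour (v : 'I_(s + m)) : 'I_k.+1 :=
  match split v with inl _ => ord0 | inr y => inord (y %% k).+1 end.

Lemma join_edgesP g : g \in join_edges ->
  exists x e, [/\ g = join_edge (x, e), #|e| = k &
    {in e &, forall y y' : 'I_m, y = y' %[mod k] -> y = y'}].
Proof.
case/imsetP => -[x e] /setXP[_]; rewrite inE => /andP[/eqP ek /forallP ep] ->.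
exists x, e; split=> // y y' ye y'e yy'.
have yk : y %% k < k by rewrite ltn_mod.
have /card_le1_eqP := ep (Ordinal yk).
by apply; rewrite !inE /= ?ye ?y'e -?yy' eqxx.
Qed.

Lemma card_join_edge g : g \in join_edges -> #|g| = k.+1.
Proof.
case/join_edgesP => x [e [-> ek _]]; rewrite cardsU1 card_imset; last exact: rshift_inj.
by rewrite /= ek; case: imsetP => // -[y _ eq]; have := eq_lrshift x y; rewrite eq eqxx.
Qed.

Lemma join_colour_inj g : g \in join_edges -> {in g &, injective join_colour}.
Proof.
case/join_edgesP => x [e [-> _ ep]] u v.
have key (a : 'I_m) : (a %% k).+1 < k.+1 by rewrite ltnS ltn_mod.
have cl x' : join_colour (lshift m x') = ord0.
  by rewrite /join_colour -[lshift m x']/(unsplit (inl x')) unsplitK.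
have cr y : val (join_colour (rshift s y)) = (y %% k).+1.
  by rewrite /join_colour -[rshift s y]/(unsplit (inr y)) unsplitK /= inordK.
case: (split_ordP u) => [a ->|a ->]; case: (split_ordP v) => [b ->|b ->];
  rewrite ?mem_join_edgel ?mem_join_edger /=.
- by move=> /eqP-> /eqP->.
- by rewrite cl => _ _ /(congr1 val); rewrite cr.
- by rewrite cl => _ _ /(congr1 val); rewrite cr.
- by move=> ae be /(congr1 val); rewrite !cr => -[] /(ep a b ae be) ->.
Qed.

(** Among the [k.+2] core vertices of an expanded clique two share one of the [k.+1] colours, yet
    they lie in a common edge, which is rainbow. Every edge contains one of the [s] left vertices,
    so [s.+1] disjoint edges are impossible. *)
Lemma ex_number_ge : 1 < k ->
  s * turan_number k m k <=
    ex_number k.+1 (s + m) [:: expanded_clique k.+1 k.+2; matching k.+1 s.+1].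
Proof.
move=> k2; rewrite -card_join_edges /ex_number; apply: leq_bigmax_cond.
apply/andP; split; first by apply/forall_inP => g gE; rewrite card_join_edge.
rewrite /free_of /= andbT; apply/andP; split; apply/existsPn => f; apply/negP.
  case/andP => /injectiveP fi /forall_inP fE.
  pose z (i : 'I_k.+2) := f (inl i).
  have /injectivePn[i [j ij cij]] : ~~ injectiveb (fun i => join_colour (z i)).
    apply/negP => /injectiveP /leq_card; rewrite !card_ord ltnn //.
  have AP : #|[set i; j]| == 2 by rewrite cards2 ij.
  pose A : clique_edge k.+2 := exist (fun A : {set 'I_k.+2} => #|A| == 2) _ AP.
  have gE : f @: expanded_edge k.+1 A \in join_edges by apply: fE; apply: imset_f.
  have zA t : t \in val A -> z t \in f @: expanded_edge k.+1 A.
    by move=> tA; apply: imset_f; rewrite inE imset_f.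
  have := join_colour_inj gE (zA i _) (zA j _) cij.
  rewrite !inE !eqxx orbT => /(_ isT isT) /fi [] eq.
  by rewrite eq eqxx in ij.
case/andP => /injectiveP fi /forall_inP fE.
have hx (i : 'I_s.+1) : exists x : 'I_s, [exists j : 'I_k.+1, f (i, j) == lshift m x].
  have gE : f @: [set (i, j) | j : 'I_k.+1] \in join_edges by apply: fE; apply: imset_f.
  have /join_edgesP[x [e [eq _ _]]] := gE.
  exists x; have : lshift m x \in join_edge (x, e) by rewrite mem_join_edgel.
  rewrite -eq => /imsetP[_ /imsetP[j _ ->] ->].
  by apply/existsP; exists j.
pose h i := xchoose (hx i).
have hi : injective h.
  move=> i i' eq; have /existsP[j /eqP ej] := xchooseP (hx i).
  have /existsP[j' /eqP ej'] := xchooseP (hx i').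
  have : f (i, j) = f (i', j') by rewrite ej ej' -/(h i) eq.
  by move/fi => [].
by have := leq_card h hi; rewrite !card_ord ltnn.
Qed.
End LowerBound.

(** * The upper bound *)

Section Upper.

Variable V : finType.
Implicit Types (e : rel V) (G : {set {set V}}) (S U g : {set V}) (x y u : V).

(** A clique either avoids [U] or lies in the neighbourhood of some [u] in [U] together with [u];
    Zykov's bound applies to both kinds. *)
Lemma card_cliques_low_degree e k U d : symmetric e -> irreflexive e ->
  cliques e k.+2 [set: V] = set0 -> {in U, forall u, #|nb e [set: V] u| <= d} ->
  #|cliques e k.+1 [set: V]| * k.+1 ^ k.+1 * k ^ k <=
    (#|V| - #|U|) ^ k.+1 * k ^ k + #|U| * k.+1 ^ k.+1 * d ^ k.
Proof.
move=> es ei e0 hd; have del := card_cliques_del k [set: V] U ei.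
apply: leq_trans (leq_mul (leq_mul del (leqnn _)) (leqnn _)) _.
rewrite !mulnDl; apply: leq_add.
  rewrite leq_mul2r; apply/orP; right; apply: leq_trans (zykov es ei _) _.
    by apply: cliques_eq0S e0; apply: subsetT.
  by rewrite setTD -(cardsC U) addKn.
rewrite !big_distrl /= -mulnA -sum_nat_const; apply: leq_sum => u uU.
rewrite mulnAC mulnC leq_mul2l; apply/orP; right.
apply: leq_trans (zykov es ei _) _; first exact: cliques_nb_eq0 (in_setT u) e0.
by case: (k) => // j; rewrite leq_exp2r ?hd.
Qed.

(** The smallest class has at most [#|S| %/ k.+1] vertices, so its minimum with [s] is at most [y],
    and balancing the other classes only increases their product. Monotonicity then replaces that
    minimum by [y]. *)
Lemma partite_bound k s S (F : {set {set V}}) (c : V -> 'I_k.+1)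
    (y := minn s (#|S| %/ k.+1)) :
  0 < k ->
  {in F, forall g : {set V}, [/\ g \subset S, #|g| = k.+1 & {in g &, injective c}]} ->
  (forall M : {set {set V}}, M \subset F -> trivIset M -> #|M| <= s) ->
  #|F| <= y * balanced_prod (#|S| - y) k.
Proof.
move=> k0 hF hM; pose n i := #|[set x in S | c x == i]|.
have [i0 _ imin] := @arg_minnP _ (@ord0 k) predT n isT.
have sumn : \sum_i n i = #|S|.
  rewrite -sum1_card (partition_big c predT) //=.
  by apply: eq_bigr => i _; rewrite sum1dep_card.
have Sn : \sum_(i | i != i0) n i = #|S| - n i0 by rewrite -sumn [X in X - _](bigD1 i0) //= addKn.
have n0S : k.+1 * n i0 <= #|S|.
  by rewrite -sumn -[X in X * _]card_ord -sum_nat_const; apply: leq_sum => i _; apply: imin.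
apply: leq_trans (partite_matching_bound hF hM (fun i => imin i isT)) _.
apply: leq_trans (leq_mul (leqnn _) (prod_le_balanced _ n)) _.
rewrite Sn cardC1 card_ord /=.
have s'y : minn s (n i0) <= y.
  by rewrite leq_min geq_minl /= (leq_trans (geq_minr _ _)) // leq_divRL // mulnC.
apply: leq_trans (_ : minn s (n i0) * balanced_prod (#|S| - minn s (n i0)) k <= _).
  by rewrite leq_mul2l balanced_prod_mono ?orbT // leq_sub2l ?geq_minr.
apply: mul_balanced_prod_mono => //.
by rewrite mulnC -leq_divRL // geq_minr.
Qed.

(* [S] is the set of vertices of high degree in the heavy graph: it induces a
   [k.+1]-partite hypergraph, while deleting a vertex outside [S] costs at most
   [y ^ k] edges, which is less than what the bound loses with the vertex. *)
Lemma edges_bound k K G s a a0 (e := heavy G K)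
    (T := fun b => [set x | #|~: nb e [set: V] x| <= b])
    (y := minn s (#|T a| %/ k.+1)) :
  1 < k -> {in G, forall g : {set V}, #|g| = k.+1} ->
  ~~ contains (Hypergraph G) (expanded_clique k.+1 k.+2) ->
  ~~ contains (Hypergraph G) (matching k.+1 s.+1) ->
  k.+2 + #|clique_edge k.+2| * k.+1 <= K ->
  a0 <= a -> k.+1 * s <= #|V| ->
  (3 * k + 2) * a < 3 * #|T a| -> (2 * k + 1) * a + k.+1 < 2 * #|T a| ->
  (K + (#|V| - #|T a0|) + k.+1 * (k.+1 * a0 - #|T a0|)) * #|V| ^ (k - 1) * k ^ k
    + (#|V| - a.+1) ^ k <= y ^ k * k ^ k ->
  #|G| <= s * balanced_prod (#|V| - s) k.
Proof.
move=> k1 Gk nH nM hK aa0 ks hA hC hdeg.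
have k0 := ltnW k1.
have es : symmetric e := @heavy_sym _ G K; have ei : irreflexive e := @heavy_irr _ G K.
have ea0 : cliques e k.+2 [set: V] = set0 by apply: (@heavy_clique_free _ k.+1).
set S := T a in y hA hC hdeg *.
have TS : T a0 \subset S by apply/subsetP => x; rewrite !inE => /leq_trans; apply.
have hT b (R : {set V}) : R \subset T b -> {in R, forall x, #|R :\: nb e R x| <= b}.
  move=> RT x xR; have := subsetP RT x xR; rewrite inE; apply: leq_trans.
  by apply/subset_leq_card/subsetP => z; rewrite !inE => /andP[+ zR]; rewrite zR.
have eS0 : cliques e k.+2 S = set0 by apply: cliques_eq0S ea0; apply: subsetT.
have [c hc] : exists c : V -> 'I_k.+1, {in S &, forall x y, e x y -> c x != c y}.
  case: (k) k0 eS0 hA => // r _ eS0 hA; apply: (andrasfai es ei eS0 (hT a S (subxx _))).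
  by move: hA; congr (_ * _ < _); lia.
have hcov := covered_pair_colour k0 Gk nH hK (hT a S (subxx _)) hc hC.
pose F := [set g in G | g \subset S].
have hF : {in F, forall g : {set V}, [/\ g \subset S, #|g| = k.+1 & {in g &, injective c}]}.
  move=> g; rewrite inE => /andP[gG gS]; split=> //; first exact: Gk.
  move=> u v ug vg cuv; apply/eqP; apply: contraT => uv.
  by have := hcov g u v gG ug vg (subsetP gS u ug) (subsetP gS v vg) uv; rewrite cuv eqxx.
have hM (M : {set {set V}}) : M \subset F -> trivIset M -> #|M| <= s.
  move=> MF; apply: (@matching_bound _ G M k.+1 s) => //.
  by apply: subset_trans MF _; apply/subsetP => g; rewrite inE => /andP[].
have FB := partite_bound k0 hF hM; rewrite -/y in FB.
have deg u : u \in ~: S -> #|[set g in G | u \in g]| <= y ^ k.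
  move=> uS; have kk : 0 < k ^ k by rewrite expn_gt0 k0.
  rewrite -(leq_pmul2r kk); apply: leq_trans _ hdeg.
  apply: leq_trans (degree_bound (c := c) u k1 Gk nH hK (hT a0 _ (subxx _)) _) _.
    move=> g x z gG xg zg /(subsetP TS) xS /(subsetP TS) zS.
    exact: hcov gG xg zg xS zS.
  rewrite leq_add2l leq_exp2r // -/e; move: uS; rewrite !inE -ltnNge.
  have := cardsC (nb e [set: V] u); lia.
have GF : #|G| <= #|F| + #|~: S| * y ^ k.
  rewrite -(cardsID F G); apply: leq_add; first exact/subset_leq_card/subsetIr.
  apply: leq_trans (card_hitting (W := ~: S) _) _.
    move=> g /setDP[gG]; rewrite inE gG /= => /subsetPn[x xg xS].
    by apply/pred0Pn; exists x; rewrite /= xg inE.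
  rewrite -sum_nat_const; apply: leq_sum => u /deg; apply: leq_trans.
  by apply/subset_leq_card/subsetP => g; rewrite !inE => /andP[/andP[_ ->] ->].
apply: leq_trans GF _; apply: leq_trans (leq_add FB (leqnn _)) _.
have yS : k.+1 * y <= #|S| by rewrite mulnC -leq_divRL // geq_minr.
have yq : y <= (#|S| - y) %/ k by rewrite leq_divRL // mulnC; move: yS; rewrite mulSn; lia.
apply: leq_trans (mul_balanced_prod_mono k0 (geq_minl _ _ : y <= s) ks).
(* Since [y <= (#|S| - y) %/ k], the cost [y ^ k] of a vertex outside [S] is at most [y] times what
   the balanced product gains when that vertex is restored. *)
apply: leq_trans (_ : y * (balanced_prod (#|S| - y) k + #|~: S| * ((#|S| - y) %/ k) ^ (k - 1)) <= _).
  rewrite mulnDr leq_add2l mulnCA leq_mul2l; apply/orP; right.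
  rewrite -{1}(subnK k0) addn1 expnS leq_mul2l; apply/orP; right.
  by rewrite leq_exp2r ?subn_gt0.
rewrite leq_mul2l; apply/orP; right.
apply: leq_trans (balanced_prod_add _ _ k0) _.
have := cardsC S; have yS' : y <= #|S| by apply: leq_trans yS; rewrite leq_pmull.
by move=> <-; rewrite addnC addnBA // addnC.
Qed.
End Upper.

Import Order.TTheory GRing.Theory Num.Theory.
Local Open Scope ring_scope.

(** * Real estimates in terms of [L] *)

Section Estimates.

Variable R : realType.
Implicit Types (x d L Q w : R) (m n : nat).

Lemma bernoulli_ge x m : 0 <= x <= 1 -> 1 - m%:R * x <= (1 - x) ^+ m.
Proof.
move=> /andP[x0 x1]; elim: m => [|m IHm]; first by rewrite mul0r subr0 expr0.
have m0 : 0 <= m%:R :> R by [].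
rewrite exprS -natr1; apply: le_trans (ler_wpM2l _ IHm); last by lra.
have : 0 <= m%:R * x * x by rewrite !mulr_ge0.
lra.
Qed.

Lemma expr_1sub_le x m : 0 <= x <= 1 -> (1 - x) ^+ m <= 1 - m%:R * x + (m%:R * x) ^+ 2.
Proof.
move=> /andP[x0 x1]; elim: m => [|m IHm]; first by rewrite !mul0r subr0 expr0 expr0n addr0.
have m0 : 0 <= m%:R :> R by [].
rewrite exprS -natr1; apply: le_trans (ler_wpM2l _ IHm) _; first by lra.
have h1 : 0 <= m%:R * x ^+ 2 by rewrite !mulr_ge0 // exprn_ge0.
have h2 : 0 <= x ^+ 2 by rewrite exprn_ge0.
have h3 : 0 <= (m%:R * x) ^+ 2 * x by rewrite !mulr_ge0 // exprn_ge0 // mulr_ge0.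
have -> : (1 - x) * (1 - m%:R * x + (m%:R * x) ^+ 2) =
  1 - (m%:R + 1) * x + ((m%:R + 1) * x) ^+ 2 - m%:R * x ^+ 2 - x ^+ 2 - (m%:R * x) ^+ 2 * x by ring.
lra.
Qed.

Lemma expr_1sub_le1 x m : 0 <= x <= 1 -> (0 < m)%N -> (1 - x) ^+ m <= 1 - x.
Proof.
move=> /andP[x0 x1]; case: m => // m _; rewrite exprS -[leRHS]mulr1 ler_wpM2l //; first by lra.
by apply: exprn_ile1; lra.
Qed.

(* [a] is the integer part of [(1 + d q) L], where [n = q L]. *)
Lemma degree_power_le k n a d L : (0 < k)%N -> 0 <= L -> 0 <= d <= 1 ->
  n%:R = k.+1%:R * L -> (1 + d * k.+1%:R) * L < a.+1%:R ->
  ((n - a.+1) ^ k)%:R <= (1 - d) * (k%:R * L) ^+ k.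
Proof.
move=> k0 L0 /andP[d0 d1] nL aL; rewrite natrX.
have kL0 : 0 <= k%:R * L by rewrite mulr_ge0.
have le1 : (n - a.+1)%:R <= (1 - d) * (k%:R * L).
  case: (leqP a.+1 n) => an; last first.
    by rewrite (eqP (ltnW an : _ - _ == 0)%N) mulr_ge0 // subr_ge0.
  rewrite natrB // nL; move: aL; rewrite -[k.+1%:R]natr1 => aL.
  have : 0 <= d * L by rewrite mulr_ge0.
  lra.
apply: le_trans (_ : ((1 - d) * (k%:R * L)) ^+ k <= _).
  by rewrite lerXn2r ?nnegrE ?mulr_ge0 ?subr_ge0.
rewrite exprMn ler_wpM2r ?exprn_ge0 //.
by apply: expr_1sub_le1 => //; rewrite d0.
Qed.

(** Deleting the [t] vertices leaves a factor [(1 - w / k.+1) ^ k.+1], at most [1 - w + w ^ 2], and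
    the cliques through them contribute at most [w * (1 - d)]. The saving [w * (d - w)] is largest
    near [w = d / 2]. *)
Lemma cliques_low_degree_real k n N t a d L w : (0 < k)%N -> 0 < L -> 0 <= d <= 1 ->
  n%:R = k.+1%:R * L -> (1 + d * k.+1%:R) * L < a.+1%:R -> (t <= n)%N ->
  t%:R = w * L ->
  (N * k.+1 ^ k.+1 * k ^ k <= (n - t) ^ k.+1 * k ^ k + t * k.+1 ^ k.+1 * (n - a.+1) ^ k)%N ->
  N%:R <= (1 - d * w + w ^+ 2) * L ^+ k.+1.
Proof.
move=> k0 L0 hd nL aL tn tw; rewrite -(ler_nat R) natrD !natrM => hN.
have q0 : 0 < k.+1%:R :> R by rewrite ltr0n.
have kk0 : 0 < (k ^ k)%:R :> R by rewrite ltr0n expn_gt0 k0.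
have qq0 : 0 < (k.+1 ^ k.+1)%:R :> R by rewrite ltr0n expn_gt0.
have w0 : 0 <= w by rewrite -(pmulr_lge0 _ L0) -tw.
have wq : w <= k.+1%:R by rewrite -(ler_pM2r L0) -tw -nL ler_nat.
have dk := degree_power_le k0 (ltW L0) hd nL aL.
have nt : ((n - t) ^ k.+1)%:R <= (1 - w + w ^+ 2) * L ^+ k.+1 * (k.+1 ^ k.+1)%:R.
  rewrite natrX natrB // nL tw.
  have -> : k.+1%:R * L - w * L = k.+1%:R * L * (1 - w / k.+1%:R).
    by move: (lt0r_neq0 q0); move: (k.+1%:R) => q q1; field.
  rewrite !exprMn natrX; have /(expr_1sub_le k.+1) : 0 <= w / k.+1%:R <= 1.
    by rewrite ler_pdivrMr // mul1r wq divr_ge0 // ltW.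
  rewrite [k.+1%:R * (w / _)]mulrC divfK ?lt0r_neq0 // => h.
  rewrite [leLHS]mulrC -mulrA [L ^+ _ * _]mulrC ler_wpM2r // mulr_ge0 // exprn_ge0 // ltW //.
have {}hN : N%:R * (k.+1 ^ k.+1)%:R * (k ^ k)%:R <=
    (1 - d * w + w ^+ 2) * L ^+ k.+1 * (k.+1 ^ k.+1)%:R * (k ^ k)%:R.
  apply: le_trans hN _.
  have -> : (1 - d * w + w ^+ 2) * L ^+ k.+1 * (k.+1 ^ k.+1)%:R * (k ^ k)%:R =
    (1 - w + w ^+ 2) * L ^+ k.+1 * (k.+1 ^ k.+1)%:R * (k ^ k)%:R
    + w * L * (k.+1 ^ k.+1)%:R * ((1 - d) * (k%:R * L) ^+ k).
    by rewrite exprMn (natrX _ k k) (exprS L); ring.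
  rewrite tw; apply: lerD; first by rewrite ler_wpM2r // ltW.
  by rewrite ler_wpM2l // mulr_ge0 // ?mulr_ge0 // ltW.
by move: hN; rewrite !ler_pM2r.
Qed.

(** After division by [(k * L) ^ k], the crudely counted edges contribute at most [eps / 4], by the
    choice of [d], and those inside the heavy neighbourhood at most [1 - eps], while the right-hand
    side is at least [1 - eps / 4]. *)
Lemma outside_degree_le k n K a a0 m0 y d eps L (Q := k.+1%:R : R) : (0 < k)%N ->
  8 * Q ^+ (k + 2) * d = eps -> 0 < d -> 0 <= eps <= 1 -> 0 < L -> n%:R = Q * L ->
  32 * K%:R <= d * L -> (m0 <= n)%N -> (n - m0)%:R <= d / 4 * L ->
  a0%:R <= (1 + d * Q) * L -> (1 + eps * Q) * L < a.+1%:R -> (1 - d / 2) * L <= y%:R ->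
  ((K + (n - m0) + k.+1 * (k.+1 * a0 - m0)) * n ^ (k - 1) * k ^ k + (n - a.+1) ^ k
     <= y ^ k * k ^ k)%N.
Proof.
move=> k0 hd d0 eps1 L0 nL KdL m0n few a0L aL yL.
have Q0 : 0 < Q by rewrite ltr0n.
have Q2 : 2 <= Q by rewrite ler_nat.
have dL0 : 0 < d * L by rewrite mulr_gt0.
have kk0 : 0 < (k ^ k)%:R :> R by rewrite ltr0n expn_gt0 k0.
have Lk0 : 0 < L ^+ k by rewrite exprn_gt0.
have deg := degree_power_le k0 (ltW L0) eps1 nL aL.
have E1 : (k.+1 * a0 - m0)%:R <= (d * Q ^+ 2 + d / 4) * L.
  case: (leqP m0 (k.+1 * a0)) => h; last first.
    rewrite (eqP (ltnW h : _ - _ == 0)%N) mulr_ge0 ?(ltW L0) //.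
    by apply: addr_ge0; [apply: mulr_ge0|apply: divr_ge0]; rewrite ?exprn_ge0 // ltW.
  rewrite natrB // natrM -/Q; have := ler_wpM2l (ltW Q0) a0L; move: few; rewrite natrB // nL.
  rewrite expr2; lra.
have E2 : (K + (n - m0) + k.+1 * (k.+1 * a0 - m0))%:R
    <= 2 * Q ^+ 3 * d * L.
  rewrite !natrD natrM -/Q; have := ler_wpM2l (ltW Q0) E1.
  have Q3Q : 4 * Q * (d * L) <= Q ^+ 3 * (d * L).
    by rewrite ler_wpM2r ?(ltW dL0) // exprSr ler_wpM2r ?(ltW Q0) // expr2; nra.
  have Q3d : 2 * (d * L) <= Q * (d * L) by rewrite ler_wpM2r // ltW.
  have -> : Q * ((d * Q ^+ 2 + d / 4) * L) = Q ^+ 3 * (d * L) + Q * (d * L) / 4.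
    by field.
  have -> : 2 * Q ^+ 3 * d * L = 2 * (Q ^+ 3 * (d * L)) by ring.
  move: few KdL Q3Q Q3d dL0; set X := Q ^+ 3 * (d * L); set Y := Q * (d * L).
  rewrite -[4 * Q * (d * L)]mulrA -/Y; set Z := d * L.
  have -> : d / 4 * L = Z / 4 by rewrite mulrAC.
  lra.

have E3 : 2 * Q ^+ 3 * d * L * (Q * L) ^+ (k - 1) = eps / 4 * L ^+ k.
  rewrite exprMn -hd; case: (k) k0 => // j _; rewrite subn1 /=.
  have -> : (j.+1 + 2 = 3 + j)%N by rewrite addSn addn2.
  by rewrite exprD (exprS L); field.
have kd : k%:R * (d / 2) <= eps / 4.
  have kQ : k%:R <= Q ^+ (k + 2).
    apply: (@le_trans _ _ Q); first by rewrite ler_nat.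
    by rewrite addn2 exprS ler_peMr ?(ltW Q0) // exprn_ege1 // ler1n.
  by rewrite -hd; have := ler_wpM2r (ltW d0) kQ; lra.
have yk : (1 - eps / 4) * L ^+ k <= (y ^ k)%:R.
  have d2 : 0 <= d / 2 <= 1.
    apply/andP; split; first by rewrite divr_ge0 // ltW.
    case/andP: eps1 => _; have : 1 <= k%:R :> R by rewrite ler1n.
    move=> k1 e1; have d20 : 0 <= d / 2 by rewrite divr_ge0 // ltW.
    by have := ler_wpM2r d20 k1; lra.
  rewrite natrX; apply: (@le_trans _ _ (((1 - d / 2) * L) ^+ k)); last first.
    by rewrite lerXn2r ?nnegrE // mulr_ge0 ?(ltW L0) // subr_ge0; case/andP: d2.
  rewrite exprMn ler_wpM2r ?(ltW Lk0) //; apply: le_trans (bernoulli_ge k d2).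
  lra.
rewrite -(ler_nat R) natrD !natrM natrX nL.
set X := (_ + _)%:R in E2 *.
have hX : X * (Q * L) ^+ (k - 1) <= eps / 4 * L ^+ k.
  by rewrite -E3 ler_wpM2r // exprn_ge0 // mulr_ge0 // ltW.
apply: le_trans (lerD (ler_wpM2r (ltW kk0) hX) deg) _.
apply: le_trans (ler_wpM2r (ltW kk0) yk).
rewrite exprMn natrX [k%:R ^+ k * _]mulrC mulrA -mulrDl ler_wpM2r ?exprn_ge0 //.
rewrite -mulrDl ler_wpM2r ?(ltW Lk0) //; case/andP: eps1; lra.
Qed.
End Estimates.

(** * Stability, choice of constants and conclusion *)

Definition high_degree (V : finType) (e : rel V) b : {set V} :=
  [set x | (#|~: nb e [set: V] x| <= b)%N].

(** In units of [L ^ k.+1], many vertices of low degree would save at least [d ^ 2 / 8]; light pairs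
    give back at most [d ^ 2 / 32], and [#|G|] is at least [1 - d ^ 2 / 16], a contradiction. *)
Lemma few_low_degree (R : realType) (V : finType) (k K s : nat) (G : {set {set V}})
    (d L : R) (Q := k.+1%:R : R) (a := Num.truncn ((1 + d * Q) * L)) :
  (1 < k)%N -> {in G, forall g : {set V}, #|g| = k.+1} ->
  ~~ contains (Hypergraph G) (expanded_clique k.+1 k.+2) ->
  (k.+2 + #|clique_edge k.+2| * k.+1 <= K)%N -> (k.+1 * s <= #|V|)%N ->
  #|V|%:R = Q * L -> 0 < d <= 1 -> 32 * (K%:R * Q ^+ k) <= d ^+ 2 * L ->
  (1 - d ^+ 2 / (16 * Q)) * L <= s%:R ->
  (s * balanced_prod (#|V| - s) k < #|G|)%N ->
  (#|V| - #|high_degree (heavy G K) a|)%:R <= d / 4 * L.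
Proof.
move=> k_gt1 Guniform Gfree K_ge s_le nL /andP[d0 d1] hL hs hG; rewrite leNgt; apply/negP => few.
have k0 := ltnW k_gt1.
have K1 : 1 <= K%:R :> R by rewrite ler1n; apply: leq_trans K_ge.
have Q1 : 1 <= Q by rewrite ler1n.
have Q0 : 0 < Q by rewrite ltr0n.
have QK1 : 1 <= K%:R * Q ^+ k by rewrite mulr_ege1 // exprn_ege1.
have d2 : d ^+ 2 <= d by rewrite expr2 ler_piMl // ltW.
have L0 : 0 < L.
  rewrite -(pmulr_rgt0 _ (exprn_gt0 2 d0)); apply: lt_le_trans hL.
  by rewrite mulr_gt0 // (lt_le_trans ltr01).
have dL : 32 <= d * L.
  apply: (@le_trans _ _ (d ^+ 2 * L)); last by rewrite ler_wpM2r // ltW.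
  by apply: le_trans hL; rewrite ler_peMr.
have dL0 : 0 <= d / 4 * L by rewrite mulr_ge0 ?divr_ge0 // ltW.
(* Not all vertices of low degree are deleted: for large [w] the term [w ^ 2] would outweigh the
   saving. The successor gives [w > d / 4], and [32 <= d * L] keeps [w <= d / 2]. *)
pose t := (Num.truncn (d / 4 * L)).+1.
have t_le : (t <= #|~: high_degree (heavy G K) a|)%N.
  by rewrite /t truncn_lt_nat // -(addKn #|high_degree (heavy G K) a| #|~: _|) cardsC.
have [U UT Ut] := exists_subset_card t_le.
have t_gt : d / 4 * L < t%:R by apply: truncnS_gt.
have t_lt : t%:R <= d / 2 * L.
  have : (Num.truncn (d / 4 * L))%:R <= d / 4 * L by rewrite truncn_le.
  by rewrite -[t%:R]natr1; lra.
pose w := t%:R / L.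
have tw : t%:R = w * L by rewrite /w divfK // lt0r_neq0.
have w_gt : d / 4 < w by rewrite -(ltr_pM2r L0) -tw.
have w_le : w <= d / 2 by rewrite -(ler_pM2r L0) -tw.
have hN := @card_cliques_low_degree V (heavy G K) k U (#|V| - a.+1)
  (@heavy_sym _ G K) (@heavy_irr _ G K)
  (heavy_clique_free (p := k) (ltnW k_gt1 : (1 < k.+1)%N) Guniform Gfree K_ge [set: V]).
have {}hN := hN _; rewrite Ut in hN.
have NL : #|cliques (heavy G K) k.+1 [set: V]|%:R <= (1 - d * w + w ^+ 2) * L ^+ k.+1.
  apply: (cliques_low_degree_real (t := t) (a := a) k0 L0 _ nL) => //.
  - by rewrite d1 ltW.
  - exact: truncnS_gt.
  - by apply: leq_trans t_le _; apply: max_card.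
  apply: hN => u /(subsetP UT); rewrite !inE -ltnNge => hu.
  by rewrite -[X in (_ <= X - _)%N](cardsC (nb (heavy G K) [set: V] u)) -addnBA // leq_addr.
have GN : #|G|%:R <= #|cliques (heavy G K) k.+1 [set: V]|%:R + d ^+ 2 / 32 * L ^+ k.+1.
  have := card_heavy_cliques K Guniform k_gt1.
  rewrite subn1 /= -(ler_nat R) natrD natrM natrX nL => /le_trans; apply.
  rewrite lerD2l exprMn (exprS L) !mulrA ler_wpM2r ?exprn_ge0 ?(ltW L0) //.
  by rewrite mulrAC ler_pdivlMr // mulrC.
have sG : (1 - d ^+ 2 / 16) * L ^+ k.+1 <= #|G|%:R.
  (* By [k.+1 * s <= #|V|], every part of the balanced partition of the other vertices has at least
     [s] elements. *)
  have le1 : (s ^ k.+1 <= #|G|)%N.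
    apply: leq_trans (ltnW hG); rewrite expnS leq_mul2l; apply/orP; right.
    apply: leq_trans (balanced_prod_ge _ _); rewrite leq_exp2r // leq_divRL //.
    have sV : (s + s * k <= #|V|)%N by rewrite (mulnC s) -mulSn.
    by rewrite leq_subRL // (leq_trans (leq_addr _ _) sV).
  apply: (@le_trans _ _ (s ^ k.+1)%:R); last by rewrite ler_nat.
  set x := d ^+ 2 / (16 * Q) in hs.
  have x01 : 0 <= x <= 1.
    have Q16 : 0 < 16 * Q by rewrite mulr_gt0.
    apply/andP; split; first by rewrite divr_ge0 ?(ltW Q16) // exprn_ge0 // ltW.
    by rewrite ler_pdivrMr // mul1r; lra.
  rewrite natrX; apply: (@le_trans _ _ (((1 - x) * L) ^+ k.+1)); last first.
    rewrite lerXn2r ?nnegrE // mulr_ge0 ?(ltW L0) // subr_ge0.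
    by case/andP: x01.
  rewrite exprMn ler_wpM2r ?exprn_ge0 ?(ltW L0) //.
  have xE (q : R) : q != 0 -> q * (d ^+ 2 / (16 * q)) = d ^+ 2 / 16 by move=> q0; field.
  by have := bernoulli_ge k.+1 x01; rewrite -/Q xE // lt0r_neq0.
have P0 : 0 < L ^+ k.+1 by rewrite exprn_gt0.
have : 1 - d ^+ 2 / 16 <= 1 - d * w + w ^+ 2 + d ^+ 2 / 32.
  rewrite -(ler_pM2r P0); apply: le_trans sG _; apply: le_trans GN _.
  by rewrite [leRHS]mulrDl lerD2r.
have : (d / 4) * (d / 2) <= w * (d - w).
  by apply: ler_pM; clear -w_gt w_le d0; lra.
have : 0 < d ^+ 2 by rewrite exprn_gt0.
rewrite !expr2; lra.
Qed.

(** The value of [eps] makes [Q * (eps * Q) = 1 / 6], which leaves room of about [L / 2] in the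
    Andrasfai-Erdos-Sos condition and [2 * L / 3] in the condition for covered pairs; the terms in
    [d] fit into it. *)
Lemma edges_bound_real (R : realType) (V : finType) (k K s : nat) (G : {set {set V}})
    (d eps L : R) (Q := k.+1%:R : R) :
  (1 < k)%N -> {in G, forall g : {set V}, #|g| = k.+1} ->
  ~~ contains (Hypergraph G) (expanded_clique k.+1 k.+2) ->
  (k.+2 + #|clique_edge k.+2| * k.+1 <= K)%N -> (k.+1 * s <= #|V|)%N ->
  ~~ contains (Hypergraph G) (matching k.+1 s.+1) ->
  6 * Q ^+ 2 * eps = 1 -> 8 * Q ^+ (k + 2) * d = eps -> 0 < d ->
  #|V|%:R = Q * L -> 32 * (K%:R * Q ^+ k) <= d ^+ 2 * L ->
  (1 - d ^+ 2 / (16 * Q)) * L <= s%:R ->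
  (#|G| <= s * balanced_prod (#|V| - s) k)%N.
Proof.
move=> k_gt1 Guniform Gfree K_ge s_le nM heps hd d0 nL hL hs; rewrite leqNgt; apply/negP => hG.
have k0 := ltnW k_gt1.
have K1 : 1 <= K%:R :> R by rewrite ler1n; apply: leq_trans K_ge.
have Q3 : 3 <= Q by rewrite ler_nat.
have Q0 : 0 < Q by rewrite ltr0n.
have Q1 : 1 <= Q by lra.
have Qk1 : 1 <= Q ^+ k by rewrite exprn_ege1.
have Q2 : 9 <= Q ^+ 2 by rewrite expr2; nra.
have Qk2 : 9 <= Q ^+ (k + 2).
  by rewrite exprD; apply: le_trans Q2 _; rewrite ler_peMl // exprn_ge0 // ltW.
have deps : 72 * d <= eps by rewrite -hd ler_wpM2r ?(ltW d0) //; lra.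
have eps0 : 0 < eps by apply: lt_le_trans deps; rewrite mulr_gt0.
have epsQ2 : 54 * eps <= 1 by rewrite -heps ler_wpM2r ?(ltW eps0) //; lra.
have d1 : d <= 1 / 3888 by lra.
set a0 := Num.truncn ((1 + d * Q) * L).
have few : (#|V| - #|high_degree (heavy G K) a0|)%:R <= d / 4 * L.
  apply: (few_low_degree k_gt1 Guniform Gfree K_ge s_le nL _ hL hs hG); rewrite d0; clear -d1; lra.
have d20 : 0 < d ^+ 2 by rewrite exprn_gt0.
have d2d : d ^+ 2 <= d by rewrite expr2 ler_piMl ?(ltW d0) //; clear -d1; lra.
have L0 : 0 < L.
  rewrite -(pmulr_rgt0 _ d20); apply: lt_le_trans hL.
  by rewrite !mulr_gt0 ?exprn_gt0 // (lt_le_trans ltr01).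
have KL : 32 * (K%:R * Q ^+ k) <= d * L by apply: le_trans hL _; rewrite ler_wpM2r // ltW.
have KdL : 32 * K%:R <= d * L.
  by apply: le_trans KL; rewrite ler_wpM2l // ler_peMr.
have QdL : 32 * Q <= d * L.
  apply: le_trans KL; rewrite ler_wpM2l //; case: (k) k0 => // j _; rewrite exprS mulrCA.
  by rewrite ler_peMr ?ltr0Sn // mulr_ege1 // exprn_ege1 // ler1n.
pose a := Num.truncn ((1 + eps * Q) * L).
have aa0 : (a0 <= a)%N.
  apply: le_truncn; rewrite ler_wpM2r ?(ltW L0) // lerD2l ler_wpM2r ?(ltW Q0) //.
  by clear -deps d0; lra.
have aL : a%:R <= (1 + eps * Q) * L.
  by rewrite truncn_le mulr_ge0 ?(ltW L0) // addr_ge0 // mulr_ge0 // ltW.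
have a0L : a0%:R <= (1 + d * Q) * L.
  by rewrite truncn_le mulr_ge0 ?(ltW L0) // addr_ge0 // mulr_ge0 // ltW.
have subV b : (#|high_degree (heavy G K) b| <= #|V|)%N by apply: max_card.
pose m0 : R := #|high_degree (heavy G K) a0|%:R; pose m : R := #|high_degree (heavy G K) a|%:R.
have m0L : (Q - d / 4) * L <= m0.
  by move: few; rewrite natrB // nL -/m0; clear; lra.
have m0m : m0 <= m.
  rewrite ler_nat; apply/subset_leq_card/subsetP => x; rewrite !inE => /leq_trans; exact.
suff : (#|G| <= s * balanced_prod (#|V| - s) k)%N by rewrite leqNgt hG.
have epsQ : Q * (eps * Q) = 1 / 6.
  have -> : Q * (eps * Q) = (6 * Q ^+ 2 * eps) / 6 by field.
  by rewrite heps.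
have epsQ0 : 0 < eps * Q by rewrite mulr_gt0.
have natq j c : (j * k + c)%:R = j%:R * (Q - 1) + c%:R :> R.
  by rewrite -[Q]natr1 addrK natrD natrM.
have dL0 : 0 < d * L by rewrite mulr_gt0.
have eQL0 : 0 < eps * Q * L by rewrite mulr_gt0.
have dL' : d * L <= L / 3888 by have := ler_wpM2r (ltW L0) d1; clear; lra.
have QQ c1 c2 : (c1 * (Q - 1) + c2) * ((1 + eps * Q) * L) =
    c1 * (Q * L) + c1 / 6 * L + (c2 - c1) * L + (c2 - c1) * (eps * Q * L).
  have -> : c1 / 6 = c1 * (Q * (eps * Q)) by rewrite epsQ; field.
  ring.
apply: (@edges_bound V k K G s a a0) => //.
- rewrite -(ltr_nat R) !natrM natq -/m.
  apply: (@le_lt_trans _ _ ((3 * (Q - 1) + 2) * ((1 + eps * Q) * L))).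
    by rewrite ler_wpM2l //; clear -Q3; lra.
  rewrite QQ; clear -m0L m0m eQL0 dL0 dL' L0; lra.
- rewrite -(ltr_nat R) natrD !natrM natq -/m.
  apply: (@le_lt_trans _ _ ((2 * (Q - 1) + 1) * ((1 + eps * Q) * L) + Q)).
    by rewrite lerD2r ler_wpM2l //; clear -Q3; lra.
  rewrite QQ; clear -m0L m0m eQL0 dL0 dL' L0 QdL; lra.
set y := minn _ _.
have yL : (1 - d / 2) * L <= y%:R.
  rewrite /y /minn; case: ifP => _.
    apply: le_trans hs; rewrite ler_wpM2r ?(ltW L0) // lerD2l lerN2.
    rewrite ler_pdivrMr ?mulr_gt0 //; apply: le_trans d2d _.
    by rewrite mulrAC -mulrA ler_peMr ?(ltW d0) //; clear -Q3; lra.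
  set D := (_ %/ _)%N; have : m < (D%:R + 1) * Q.
    by rewrite natr1 -natrM ltr_nat; apply: ltn_ceil.
  rewrite -(ler_pM2r Q0); have : 3 * (d * L) <= Q * (d * L) by rewrite ler_wpM2r // ltW.
  clear -m0L m0m QdL dL0; lra.
apply: (outside_degree_le (d := d) (eps := eps) (L := L)) => //.
- by rewrite ltW //=; clear -epsQ2; lra.
- exact: max_card.
- exact: truncnS_gt.
Qed.

Theorem theorem1p6 (R : realType) (k : nat) (hk : (3 <= k)%N) :
  exists (beta : R) (s0 : nat), 0 < beta /\
    forall n s : nat,
      Num.max s0%:R (n%:R / k%:R - beta * n%:R) < s%:R :> R ->
      s%:R <= (n%:R - k%:R) / k%:R :> R ->
      ex_number k n [:: expanded_clique k k.+1; matching k s.+1] =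
        (s * turan_number k.-1 (n - s) k.-1)%N.
Proof.
case: k hk => // k k_gt1; rewrite succnK; have k0 : (0 < k)%N := ltnW k_gt1.
pose Q : R := k.+1%:R; have Q0 : 0 < Q by rewrite ltr0n.
pose K := (k.+2 + #|clique_edge k.+2| * k.+1)%N.
pose eps := (6 * Q ^+ 2)^-1; pose d := eps / (8 * Q ^+ (k + 2)).
have eps0 : 0 < eps by rewrite invr_gt0 mulr_gt0 // exprn_gt0.
have d0 : 0 < d by rewrite divr_gt0 // mulr_gt0 // exprn_gt0.
have heps : 6 * Q ^+ 2 * eps = 1 by rewrite divff // lt0r_neq0 // mulr_gt0 // exprn_gt0.
have hd : 8 * Q ^+ (k + 2) * d = eps.
  by rewrite mulrC divfK // lt0r_neq0 // mulr_gt0 // exprn_gt0.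
(* Here [beta * n] is [d ^+ 2 / (16 * Q) * L], the distance from [s] to [L] that [few_low_degree]
   tolerates. Since [s <= L], the choice of [s0] makes [L] large enough to absorb the light
   pairs. *)
exists (d ^+ 2 / (16 * Q ^+ 2)), (Num.truncn (32 * (K%:R * Q ^+ k) / d ^+ 2)).+1.
split; first by rewrite divr_gt0 ?(exprn_gt0 2 d0) // mulr_gt0 // exprn_gt0.
move=> n s; rewrite -/Q gt_max => /andP[hs0 hs]; rewrite ler_pdivlMr // => hsn.
have sn : (k.+1 * s <= n)%N.
  rewrite -(ler_nat R) natrM -/Q mulrC; apply: le_trans hsn _.
  by rewrite gerBl ltW.
pose L : R := n%:R / Q.
have nL : n%:R = Q * L by rewrite mulrC divfK // lt0r_neq0.
have sL : s%:R <= L by rewrite ler_pdivlMr // -natrM ler_nat mulnC.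
have hL : 32 * (K%:R * Q ^+ k) <= d ^+ 2 * L.
  rewrite -ler_pdivrMl ?exprn_gt0 // mulrC; apply: le_trans sL; apply: ltW; apply: lt_trans hs0.
  exact: truncnS_gt.
have {}hs : (1 - d ^+ 2 / (16 * Q)) * L <= s%:R.
  apply: le_trans (ltW hs); rewrite /L mulrBl mul1r lerD2l lerN2.
  by rewrite expr2 !invfM !mulrA [leRHS]mulrAC lexx.
have s_n : (s <= n)%N by apply: leq_trans sn; rewrite leq_pmull.
apply/eqP; rewrite eqn_leq; apply/andP; split; last first.
  have := ex_number_ge s (n - s) k0 k_gt1.
  by rewrite subnKC.
apply/bigmax_leqP => E /andP[Eu /and3P[Efree Ematch _]].
have Euni : {in E, forall g : {set 'I_n}, #|g| = k.+1} by move=> g gE; apply/eqP/(forall_inP Eu).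
apply: (@leq_trans (s * balanced_prod (n - s) k)).
  have := @edges_bound_real R 'I_n k K s E d eps L k_gt1 Euni Efree (leqnn _).
  by rewrite card_ord; apply.
by rewrite leq_mul2l turan_number_ge ?orbT.
Qed.
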